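(* Let $M$ be a left $R$-module that is projective in $\sigma[M]$ and semiprime. If $M$ satisfies ACC on annihilators and every submodule $0\neq N\subseteq M$ contains a uniform submodule, then there is a bijective correspondence between $\mathcal{E}_{\chi(M)}(M)$ and $\mathcal{P}_M^{Min}=\{\chi(M/P)\mid P\subseteq M \text{ is minimal prime in } M\}$.
   Context: $R$ is an associative ring with unity; modules are unitary left $R$-modules. For a left $R$-module $M$, a module $X$ is $M$-generated if it is an epimorphic image of a direct sum of copies of $M$, and $\sigma[M]$ is the full subcategory of left $R$-modules isomorphic to a submodule of an $M$-generated module. $M$ is projective in $\sigma[M]$ if $\mathrm{Hom}_R(M,-)$ is exact on short exact sequences in $\sigma[M]$. A submodule $N\subseteq M$ is fully invariant if $f(N)\subseteq N$ for all $f\in \mathrm{End}_R(M)$. For submodules $K,L$ of $M$, $K_ML=\sum\{f(K)\mid f\in \mathrm{Hom}_R(M,L)\}$. A fully invariant submodule $N\neq M$ is prime in $M$ if for all fully invariant submodules $K,L$ of $M$, $K_ML\subseteq N$ implies $K\subseteq N$ or $L\subseteq N$; it is semiprime in $M$ if for every fully invariant submodule $K$ of $M$, $K_MK\subseteq N$ implies $K\subseteq N$. $M$ is a semiprime module if $0$ is semiprime in $M$ (in particular $M\ne 0$). A minimal prime in $M$ is a submodule prime in $M$ that is minimal under inclusion among the submodules prime in $M$. $M$ satisfies ACC on annihilators if the set $\{\bigcap_{f\in X}\ker f\mid X\subseteq \mathrm{End}_R(M)\}$ satisfies the ascending chain condition. A module is uniform if it is nonzero and any two of its nonzero submodules have nonzero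 intersection. Injective hulls exist in $\sigma[M]$; $\widehat{X}$ denotes the injective hull of $X$ in $\sigma[M]$. For $X\in\sigma[M]$, $\chi(X)$ is the greatest hereditary torsion theory on $\sigma[M]$ for which $X$ is torsion free (the one cogenerated by $X$): $N\in\sigma[M]$ is $\chi(X)$-torsion iff $\mathrm{Hom}_R(N,\widehat{X})=0$, and $\chi(X)$-torsion free iff it has no nonzero $\chi(X)$-torsion submodule. For a hereditary torsion theory $\tau$ on $\sigma[M]$, $\mathcal{E}_{\tau}(M)$ denotes a complete set of representatives of isomorphism classes of indecomposable $\tau$-torsion free modules that are injective in $\sigma[M]$. *)

(* Defs.v *)
From HB Require Import structures.
From mathcomp Require Import all_boot all_algebra.
From mathcomp Require Import boolp classical_sets functions cardinality.

Set Implicit Arguments.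
Unset Strict Implicit.
Unset Printing Implicit Defensive.

Import GRing.Theory.
Local Open Scope ring_scope.
Local Open Scope quotient_scope.
Local Open Scope classical_set_scope.

Section ZeroSubmodule.
Variables (R : pzRingType) (M : lmodType R).

Definition zero_submod : {pred M} := [pred x | x == 0].

Let zero_submod_closed : submod_closed zero_submod.
Proof.
by split=> [|a x y]; rewrite ?inE // => /eqP-> /eqP->; rewrite scaler0 addr0.
Qed.

HB.instance Definition _ :=
  GRing.isSubmodClosed.Build R M zero_submod zero_submod_closed.

End ZeroSubmodule.

Section SubmoduleAsModule.
Variables (R : pzRingType) (M : lmodType R) (P : submodClosed M).

Record submod := Submod { submod_val :> M; _ : submod_val \in P }.

HB.instance Definition _ := [isSub for submod_val].
HB.instance Definition _ := [Choice of submod by <:].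
HB.instance Definition _ := [SubChoice_isSubLmodule of submod by <:].

End SubmoduleAsModule.

Section QuotientModule.
Variables (R : pzRingType) (M : lmodType R) (P : submodClosed M).

(* P as a subgroup of M: a [submodClosed] is not a [zmodClosed] in the library. *)
Definition submod_zmod : {pred M} := P.

HB.instance Definition _ :=
  GRing.isZmodClosed.Build M submod_zmod (GRing.submod_closedB (submodClosedP P)).

Definition quotmod : Type := Quotient.quot submod_zmod.

HB.instance Definition _ := GRing.Zmodule.on quotmod.
HB.instance Definition _ : EqQuotient M (Quotient.equiv submod_zmod) quotmod :=
  EqQuotient.on quotmod.

Definition quotmod_scale (a : R) : quotmod -> quotmod :=
  lift_op1 quotmod ( *:%R a).

Let pi_scale a : {morph \pi_quotmod : x / a *: x >-> quotmod_scale a x}.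
Proof.
move=> x; unlock quotmod_scale; apply/eqP.
rewrite piE Quotient.equivE -scalerBr.
by rewrite (rpredZ (s := P)) // -[_ \in _]/(_ \in submod_zmod) Quotient.idealrBE reprK.
Qed.

Let pi_add : {morph \pi_quotmod : x y / x + y}.
Proof. exact: Quotient.pi_add. Qed.

Let scaleA a b v : quotmod_scale a (quotmod_scale b v) = quotmod_scale (a * b) v.
Proof. by rewrite -[v]reprK -!pi_scale scalerA. Qed.
Let scale1 : left_id 1 quotmod_scale.
Proof. by move=> v; rewrite -[v]reprK -pi_scale scale1r. Qed.
Let scaleDr : right_distributive quotmod_scale +%R.
Proof.
by move=> a u v; rewrite -[u]reprK -[v]reprK -!(pi_scale, pi_add) scalerDr.
Qed.
Let scaleDl v : {morph quotmod_scale^~ v : a b / a + b}.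
Proof. by move=> a b; rewrite -[v]reprK -!pi_scale -pi_add scalerDl. Qed.

HB.instance Definition _ :=
  GRing.Zmodule_isLmodule.Build R quotmod scaleA scale1 scaleDr scaleDl.

End QuotientModule.

Section DirectSum.
Variables (R : pzRingType) (I : Type) (M : lmodType R).

Definition finsupp_pred : {pred I -> M} :=
  [pred f : I -> M | `[< finite_set [set i | f i != 0] >]].

Let finsupp_pred_closed : submod_closed finsupp_pred.
Proof.
split=> [|a f g].
  by apply: asboolT; apply: (@sub_finite_set _ _ set0) => // i /=; rewrite eqxx.
move=> /asboolP ff /asboolP fg; apply: asboolT.
apply: (@sub_finite_set _ _ ([set i | f i != 0] `|` [set i | g i != 0])).
  move=> i; rewrite /= -[(a *: f + g) i]/(a *: f i + g i).
  have [->|] := eqVneq (f i) 0; last by left.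
  by rewrite scaler0 add0r; right.
by rewrite finite_setU.
Qed.

HB.instance Definition _ :=
  GRing.isSubmodClosed.Build R (I -> M) finsupp_pred finsupp_pred_closed.

(* The direct sum of copies of M indexed by I. *)
Definition direct_sum : lmodType R := submod finsupp_pred.

End DirectSum.

Section Sigma.
Variables (R : pzRingType) (M : lmodType R).

Definition isomorphic (X Y : lmodType R) : Prop :=
  exists f : {linear X -> Y}, bijective f.

Definition generated (X : lmodType R) : Prop :=
  exists (I : Type) (f : {linear direct_sum I M -> X}),
    forall x, exists m, f m = x.

Definition in_sigma (N : lmodType R) : Prop :=
  exists (X : lmodType R) (P : submodClosed X),
    generated X /\ isomorphic N (submod P).

Definition short_exact (A B C : lmodType R)
    (f : {linear A -> B}) (g : {linear B -> C}) : Prop :=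
  [/\ injective f, (forall b, g b = 0 <-> exists a, f a = b)
    & forall c, exists b, g b = c].

(* Exactness of 0 -> Hom(P, A) -> Hom(P, B) -> Hom(P, C) -> 0 for every
   short exact sequence 0 -> A -> B -> C -> 0 in sigma[M]. *)
Definition projective_in_sigma (P : lmodType R) : Prop :=
  forall (A B C : lmodType R) (f : {linear A -> B}) (g : {linear B -> C}),
    in_sigma A -> in_sigma B -> in_sigma C -> short_exact f g ->
    [/\ (forall u v : {linear P -> A}, f \o u =1 f \o v -> u =1 v),
        (forall v : {linear P -> B},
           (forall x, g (v x) = 0) <-> exists u : {linear P -> A}, f \o u =1 v)
      & forall w : {linear P -> C}, exists v : {linear P -> B}, g \o v =1 w].

Definition injective_in_sigma (E : lmodType R) : Prop :=
  in_sigma E /\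
  forall (A B : lmodType R) (j : {linear A -> B}) (h : {linear A -> E}),
    in_sigma A -> in_sigma B -> injective j ->
    exists h' : {linear B -> E}, h' \o j =1 h.

Definition essential (X E : lmodType R) (i : {linear X -> E}) : Prop :=
  forall K : submodClosed E, (exists2 y, y \in K & y != 0) ->
    exists x, i x \in K /\ i x != 0.

Definition injective_hull_in_sigma (X E : lmodType R) (i : {linear X -> E}) :
    Prop :=
  [/\ injective_in_sigma E, injective i & essential i].

(* A hereditary torsion theory on sigma[M] is represented by its class of
   torsion modules, which determines the torsion free ones. *)
Definition torsion_theory : Type := lmodType R -> Prop.

Definition torsion_free (tau : torsion_theory) (N : lmodType R) : Prop :=
  in_sigma N /\
  forall K : submodClosed N, tau (submod K) -> forall x, x \in K -> x = 0.

(* The hull of X is unique up to isomorphism over X, so it does not matter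
   which one is taken. *)
Definition chi (X : lmodType R) : torsion_theory :=
  fun N => in_sigma N /\
    exists (E : lmodType R) (i : {linear X -> E}),
      injective_hull_in_sigma i /\ forall f : {linear N -> E}, f =1 (fun=> 0).

Definition indecomposable (E : lmodType R) : Prop :=
  (exists x : E, x != 0) /\
  forall A B : submodClosed E,
    (forall x, exists a b, [/\ a \in A, b \in B & x = a + b]) ->
    (forall x, x \in A -> x \in B -> x = 0) ->
    (forall x, x \in A -> x = 0) \/ (forall x, x \in B -> x = 0).

(* EE is one of the possible choices for the set of representatives of the
   indecomposable tau-torsion free injectives of sigma[M]. *)
Definition complete_representatives (tau : torsion_theory)
    (EE : lmodType R -> Prop) : Prop :=
  let indec_inj E :=
    [/\ indecomposable E, torsion_free tau E & injective_in_sigma E] in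
  (forall E, EE E -> indec_inj E) /\
  forall E, indec_inj E -> exists! E', EE E' /\ isomorphic E E'.

End Sigma.

Section Primes.
Variables (R : pzRingType) (M : lmodType R).

Definition fully_invariant (N : submodClosed M) : Prop :=
  forall (f : {linear M -> M}) x, x \in N -> f x \in N.

(* The product K_M L: the finite sums of elements of the f(K), f in Hom(M, L). *)
Definition submod_prod (K L : submodClosed M) : set M :=
  [set x | exists n (f : 'I_n -> {linear M -> submod L}) (k : 'I_n -> M),
    (forall i, k i \in K) /\ x = \sum_(i < n) submod_val (f i (k i))].

Definition prime_in (N : submodClosed M) : Prop :=
  [/\ fully_invariant N, (exists x, x \notin N)
    & forall K L : submodClosed M, fully_invariant K -> fully_invariant L ->
        submod_prod K L `<=` [set` N] ->
        {subset K <= N} \/ {subset L <= N}].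

Definition semiprime_in (N : submodClosed M) : Prop :=
  [/\ fully_invariant N, (exists x, x \notin N)
    & forall K : submodClosed M, fully_invariant K ->
        submod_prod K K `<=` [set` N] -> {subset K <= N}].

Definition semiprime_module : Prop := semiprime_in (@zero_submod R M).

Definition minimal_prime_in (P : submodClosed M) : Prop :=
  prime_in P /\
  forall Q : submodClosed M, prime_in Q -> {subset Q <= P} -> {subset P <= Q}.

Definition min_prime_theories : torsion_theory R -> Prop :=
  fun tau => exists2 P : submodClosed M,
    minimal_prime_in P & tau = chi M (quotmod P).

Definition annihilator (X : set {linear M -> M}) : set M :=
  \bigcap_(f in X) [set x | f x = 0].

Definition acc_on_annihilators : Prop :=
  forall A : nat -> set M,
    (forall n, range annihilator (A n)) -> (forall n, A n `<=` A n.+1) ->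
    exists n, forall m, (n <= m)%N -> A m = A n.

End Primes.

Definition uniform (R : pzRingType) (U : lmodType R) : Prop :=
  (exists x : U, x != 0) /\
  forall K L : submodClosed U,
    (exists2 x, x \in K & x != 0) -> (exists2 x, x \in L & x != 0) ->
    exists x, [/\ x \in K, x \in L & x != 0].

Definition submodules_contain_uniform (R : pzRingType) (M : lmodType R) : Prop :=
  forall N : submodClosed M, (exists2 x, x \in N & x != 0) ->
    exists2 U : submodClosed M, {subset U <= N} & uniform (submod U).

(* [set (lmodType R)] is a universe inconsistency, because the library makes
   types built from [set] carriers of modules; so classes of modules are plain
   predicates, and [set_bij] is unavailable for them. *)
Definition class_bij (T U : Type) (A : T -> Prop) (B : U -> Prop) (F : T -> U) :
    Prop :=
  [/\ (forall x, A x -> B (F x)),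
      (forall x y, A x -> A y -> F x = F y -> x = y)
    & forall y, B y -> exists2 x, A x & F x = y].

(* Main.v *)
Require Import Defs.
From HB Require Import structures.
From mathcomp Require Import all_boot all_order all_algebra.
From mathcomp Require Import boolp classical_sets functions cardinality fsbigop.

Set Implicit Arguments.
Unset Strict Implicit.
Unset Printing Implicit Defensive.

Import GRing.Theory Num.Theory.
Local Open Scope ring_scope.
Local Open Scope quotient_scope.
Local Open Scope classical_set_scope.

(** The bijection is [E |-> chi M E].  Two reformulations make torsion theories
    concrete.  A module lies in sigma[M] exactly when the annihilator of each of
    its elements contains the annihilator of a finite subset of M
    ([in_sigmaP]); and N is chi(X)-torsion exactly when no submodule of N has a
    nonzero map to X ([chiP]).  The second one uses the existence of injective
    hulls in sigma[M], built here by embedding into a product of coinduced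
    modules Hom_Z(R, Q/Z), cutting down to the elements that sigma[M] allows,
    and splitting off a maximal essential extension.

    The algebra rests on two consequences of the hypotheses on M.
    Projectivity lets a map into the sum of all f(N), f in End(M), be lifted to
    the direct sum of copies of N; with semiprimeness this gives, for
    every nonzero submodule N of M, a map h : M -> N with h(N) nonzero
    ([ex_map_nonzero]).  The ascending chain condition then yields, for every
    uniform U in M, a map M -> U that is injective on U
    ([uniform_ex_map_inj]): take f : M -> U with f(U) nonzero and with the
    largest kernel, and follow it by a map M -> f(U) that is nonzero on f(U).
    By projectivity, a uniform submodule of M that is an epimorphic image of a
    module A of sigma[M] embeds in A ([uniform_split]).

    Primes.  For U uniform in M, let P be the reject of U, the common kernel of
    all maps M -> U.  It is a minimal prime, since the maps injective on U keep
    products inside U from vanishing, and every minimal prime arises in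
    this way: otherwise, among the fully invariant submodules K not contained
    in the given prime, choose one with the largest annihilator; a uniform U
    inside K lies in the annihilator of the intersection of K with the reject
    of U, hence in that of K, which is absurd.  Since U embeds in M/P and M/P
    is cogenerated by U, chi(M/P) = chi(U) ([chi_quot_reject]).

    Injectives.  An indecomposable chi(M)-torsion free injective E has a
    submodule with a nonzero map to M, hence onto a uniform U in M, so U embeds
    in E, essentially by indecomposability, and chi(E) = chi(U).  Conversely
    the hull of each U is such an E.  Finally, chi(U) = chi(U') gives
    a nonzero module embedded in both U and U', and then the hulls are
    isomorphic ([indecomposable_iso]). *)

(** * Submodules, quotients and maps out of direct sums *)

Section Toolkit.
Variable R : pzRingType.
Implicit Types X Y Z : lmodType R.

Lemma ex_linear X Y (f : X -> Y) :
  (forall a x y, f (a *: x + y) = a *: f x + f y) ->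
  exists g : {linear X -> Y}, forall x, g x = f x.
Proof.
move=> lin_f.
pose g : {linear X -> Y} := HB.pack f (GRing.isLinear.Build R X Y *:%R f lin_f).
by exists g.
Qed.

Lemma ex_submod X (S : X -> Prop) :
  S 0 -> (forall a x y, S x -> S y -> S (a *: x + y)) ->
  exists P : submodClosed X, forall x, (x \in P) <-> S x.
Proof.
move=> S0 SD; pose p : {pred X} := [pred x | `[< S x >]].
have pE x : (x \in p) = `[< S x >] by [].
have cp : submod_closed p.
  split=> [|a x y]; rewrite !pE; first exact/asboolP.
  by move=> /asboolP Sx /asboolP Sy; apply/asboolP; apply: SD.
pose P : submodClosed X := HB.pack p (GRing.isSubmodClosed.Build R X p cp).
by exists P => x; split => [/asboolP|Sx] //; apply/asboolP.
Qed.

Lemma ex_kernel X Y (f : {linear X -> Y}) :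
  exists P : submodClosed X, forall x, x \in P <-> f x = 0.
Proof.
apply: ex_submod => [|a x y fx fy]; first exact: linear0.
by rewrite linearP fx fy scaler0 addr0.
Qed.

Lemma ex_preimage X Y (f : {linear X -> Y}) (S : submodClosed Y) :
  exists P : submodClosed X, forall x, x \in P <-> f x \in S.
Proof.
apply: ex_submod => [|a x y Sx Sy]; first by rewrite linear0 rpred0.
by rewrite linearP rpredD ?rpredZ.
Qed.

Lemma ex_image_submod X Y (f : {linear X -> Y}) (S : submodClosed X) :
  exists P : submodClosed Y, forall y, y \in P <-> exists2 x, x \in S & f x = y.
Proof.
apply: ex_submod; first by exists 0; rewrite ?rpred0 ?linear0.
move=> a _ _ [x1 S1 <-] [x2 S2 <-]; exists (a *: x1 + x2); last exact: linearP.
by rewrite rpredD ?rpredZ.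
Qed.

Lemma ex_range X Y (f : {linear X -> Y}) :
  exists P : submodClosed Y, forall y, y \in P <-> exists x, f x = y.
Proof.
apply: ex_submod; first by exists 0; rewrite linear0.
by move=> a _ _ [x1 <-] [x2 <-]; exists (a *: x1 + x2); rewrite linearP.
Qed.

Lemma ex_intersection X (S T : submodClosed X) :
  exists P : submodClosed X, forall x, x \in P <-> x \in S /\ x \in T.
Proof.
apply: ex_submod; first by rewrite !rpred0.
by move=> a x y [Sx Tx] [Sy Ty]; rewrite !rpredD ?rpredZ.
Qed.

Lemma ex_submod_val X (P : submodClosed X) :
  exists i : {linear submod P -> X}, [/\ injective i,
    forall x, i x = submod_val x, forall x, i x \in P &
    forall x, x \in P -> exists y, i y = x].
Proof.
exists (\val : {linear submod P -> X}); split=> //.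
- by move=> x; apply: (valP x).
- by move=> x Px; exists (Submod Px).
Qed.

Lemma ex_quot X (P : submodClosed X) :
  exists p : {linear X -> quotmod P},
    (forall x, p x = 0 <-> x \in P) /\ (forall y, exists x, p x = y).
Proof.
have eqP' x y : (\pi_(quotmod P) x = \pi_(quotmod P) y) <-> (x - y \in P).
  split=> [/eqP|Pxy]; first by rewrite piE Quotient.equivE.
  by apply/eqP; rewrite piE Quotient.equivE.
have piZ a x : \pi_(quotmod P) (a *: x) = a *: \pi_(quotmod P) x.
  rewrite -[RHS]/(quotmod_scale a _); unlock quotmod_scale.
  by apply/eqP'; rewrite -scalerBr rpredZ //; apply/eqP'; rewrite reprK.
have [|p pE] := @ex_linear X (quotmod P) (\pi_(quotmod P)).
  by move=> a x y; rewrite -piZ; exact: Quotient.pi_add.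
have p0 : \pi_(quotmod P) 0 = 0 by rewrite -pE linear0.
exists p; split=> [x|y]; last by exists (repr y); rewrite pE reprK.
by rewrite pE -p0 eqP' subr0.
Qed.

Lemma ex_corestrict X Y Z (i : {linear X -> Z}) (f : {linear Y -> Z}) :
  injective i -> (forall y, exists x, i x = f y) ->
  exists g : {linear Y -> X}, forall y, i (g y) = f y.
Proof.
move=> inj_i /choice[g0 g0E].
have [|g gE] := @ex_linear Y X g0.
  by move=> a x y; apply: inj_i; rewrite g0E !linearP !g0E.
by exists g => y; rewrite gE.
Qed.

(** The preimage under [f] of a submodule, the submodule being given by an
    injection [g]; it plays the part of a restriction of [f] in codomain and
    domain at once. *)
Lemma ex_pullback X Y Z (f : {linear X -> Z}) (g : {linear Y -> Z}) :
  injective g ->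
  exists (A : lmodType R) (i : {linear A -> X}) (h : {linear A -> Y}),
    [/\ injective i, forall a, g (h a) = f (i a) &
        forall x y, f x = g y -> exists2 a, i a = x & h a = y].
Proof.
move=> inj_g.
have [||P PE] := @ex_submod X (fun x => exists y, g y = f x).
- by exists 0; rewrite !linear0.
- move=> a x1 x2 [y1 e1] [y2 e2]; exists (a *: y1 + y2).
  by rewrite !linearP e1 e2.
have [i [inj_i _ iP iS]] := ex_submod_val P.
have [|h hE] := @ex_corestrict Y (submod P) Z g (f \o i) inj_g.
  by move=> a; apply/PE/iP.
exists (submod P), i, h; split=> // x y fx.
have [|a ia] := iS x; first by apply/PE; exists y.
by exists a => //; apply: inj_g; rewrite hE /= ia.
Qed.

Lemma ex_image X Y (f : {linear X -> Y}) :
  exists (A : lmodType R) (p : {linear X -> A}) (i : {linear A -> Y}),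
    [/\ injective i, forall x, i (p x) = f x & forall a, exists x, p x = a].
Proof.
have [P PE] := ex_range f.
have [i [inj_i _ iP iS]] := ex_submod_val P.
have [|p pE] := @ex_corestrict (submod P) X Y i f inj_i.
  by move=> x; apply/iS/PE; exists x.
exists (submod P), p, i; split=> // a.
by have /PE[x fx] := iP a; exists x; apply: inj_i; rewrite pE.
Qed.

Lemma linear_inj X Y (f : {linear X -> Y}) :
  (forall x, f x = 0 -> x = 0) -> injective f.
Proof.
move=> f0 x y fxy; apply/eqP; rewrite -subr_eq0; apply/eqP/f0.
by rewrite linearB fxy subrr.
Qed.

Lemma inj_eq0 X Y (f : {linear X -> Y}) x : injective f -> f x = 0 -> x = 0.
Proof. by move=> inj_f fx0; apply: inj_f; rewrite linear0. Qed.

Lemma ex_factor X Y Z (p : {linear X -> Y}) (f : {linear X -> Z}) :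
  (forall y, exists x, p x = y) -> (forall x, p x = 0 -> f x = 0) ->
  exists g : {linear Y -> Z}, forall x, g (p x) = f x.
Proof.
move=> /choice[s sE] kpf.
have fs x y : p x = y -> f (s y) = f x.
  move=> pxy; apply/eqP; rewrite -subr_eq0 -linearB; apply/eqP/kpf.
  by rewrite linearB sE pxy subrr.
have [a y z|g gE] := @ex_linear Y Z (fun y => f (s y)).
  by rewrite -linearP; apply: fs; rewrite linearP !sE.
by exists g => x; rewrite gE; apply: fs.
Qed.

Lemma direct_sum_finite (I : Type) X (f : direct_sum I X) :
  finite_set [set i | submod_val f i != 0].
Proof. by case: f => f /= /asboolP. Qed.

Lemma ex_direct_sum (I : Type) X (f : I -> X) :
  finite_set [set i | f i != 0] ->
  exists g : direct_sum I X, submod_val g = f.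
Proof.
move=> fin_f; have Pf : f \in @finsupp_pred R I X by apply/asboolP.
by exists (Submod Pf).
Qed.

Lemma ex_delta (I : choiceType) X (i : I) (x : X) :
  exists f : direct_sum I X,
    forall k, submod_val f k = if k == i then x else 0.
Proof.
have [|f fE] := @ex_direct_sum I X (fun k => if k == i then x else 0).
  apply: (@sub_finite_set _ _ [set i]) => // k /=.
  by case: (k =P i) => // _; rewrite eqxx.
by exists f => k; rewrite fE.
Qed.

(** The universal map out of a direct sum, characterised by just what is used
    of it: it vanishes when every component does, and it agrees with [g i] on
    elements concentrated at [i]. *)
Lemma ex_direct_sum_map (I : choiceType) X Y (g : I -> {linear X -> Y}) :
  exists h : {linear direct_sum I X -> Y},
    (forall f, (forall i, g i (submod_val f i) = 0) -> h f = 0) /\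
    (forall f i, (forall k, k != i -> submod_val f k = 0) ->
       h f = g i (submod_val f i)).
Proof.
pose h0 (f : direct_sum I X) : Y := \sum_(i \in [set: I]) g i (submod_val f i).
have [a f1 f2|h hE] := @ex_linear (direct_sum I X) Y h0.
  (* All three sums are taken over one finite set D that supports f1 and f2. *)
  pose D := [set i | submod_val f1 i != 0] `|` [set i | submod_val f2 i != 0].
  have finD : finite_set D by rewrite finite_setU; split; apply: direct_sum_finite.
  have fD (f : direct_sum I X) : (forall i, ~ D i -> submod_val f i = 0) ->
    h0 f = \sum_(i \in D) g i (submod_val f i).
    move=> fD0; apply/esym/fsbig_widen => // i [_ nDi] /=.
    by rewrite fD0 // linear0.
  have D1 i : ~ D i -> submod_val f1 i = 0.
    by move=> nDi; apply: contra_notP nDi => /eqP; left.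
  have D2 i : ~ D i -> submod_val f2 i = 0.
    by move=> nDi; apply: contra_notP nDi => /eqP; right.
  rewrite !fD // => [|i nDi]; last first.
    rewrite -[submod_val _ i]/(a *: submod_val f1 i + submod_val f2 i).
    by rewrite D1 // D2 // scaler0 addr0.
  rewrite !fsbig_finite //= scaler_sumr -big_split /=.
  by apply: eq_bigr => i _; rewrite -linearP.
exists h; split=> [f f0|f i fi]; rewrite hE /h0.
  by apply: fsbig1 => i _; apply: f0.
apply: etrans (fsbig_set1 _ i (fun k => g k (submod_val f k))).
apply/esym/fsbig_widen => // k [_ /= /eqP ki].
by rewrite fi // linear0.
Qed.

End Toolkit.

(** * Membership in sigma[M], tested elementwise *)

Section Sigma.
Variables (R : pzRingType) (M : lmodType R).
Implicit Types X Y N : lmodType R.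

Definition locally_subgenerated N (x : N) : Prop :=
  exists s : seq M, forall r : R, {in s, forall m, r *: m = 0} -> r *: x = 0.

(** This criterion replaces submodules of M-generated modules by a condition
    that visibly passes to submodules, images and direct sums.  For the converse
    direction, choose for each [x] a finite family [s x] whose annihilator kills
    [x].  The element of the free module on [N] with coordinates [r x] is sent
    by [al] to the sum of the [r x *: x] in [N], and by [b] to the family of the
    [r x *: m], [m] in [s x], in a direct sum of copies of [M].  The choice
    of [s] makes the kernel of [b] smaller than that of [al], so [N] embeds in the
    quotient of the direct sum by [b (ker al)]. *)
Lemma in_sigmaP N : in_sigma M N <-> forall x : N, locally_subgenerated x.
Proof.
split=> [[X [P [[I [p surj_p]] [f [g fK gK]]]]] x|locN].
  have [i [inj_i _ _ _]] := ex_submod_val P.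
  have [h ph] := surj_p (i (f x)).
  have /finite_seqP[s sE] : finite_set [set submod_val h k | k in [set k | submod_val h k != 0]].
    exact/finite_image/direct_sum_finite.
  exists s => r rs0.
  have rh : r *: h = 0.
    apply: val_inj => /=; apply: funext => k.
    rewrite -[LHS]/(r *: submod_val h k) -[RHS]/(0 : M).
    have [->|hk0] := eqVneq (submod_val h k) 0; first by rewrite scaler0.
    apply: rs0; suff : [set` s] (submod_val h k) by [].
    by rewrite -sE; exists k.
  have: i (f (r *: x)) = 0 by rewrite !linearZ /= -ph -linearZ rh linear0.
  by move/(inj_eq0 inj_i)/(inj_eq0 (can_inj fK)).
have [s sE] := choice locN.
have /choice[ga gaE] (x : N) :
    exists g : {linear R^o -> N}, forall r : R, g r = r *: x.
  apply: (@ex_linear R R^o N (fun r => (r : R) *: x)) => a r1 r2.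
  by rewrite scalerDl scalerA.
have [al [al0 al1]] := ex_direct_sum_map ga.
pose b0 (r : direct_sum N R^o) (k : N * nat) : M :=
  (submod_val r k.1 : R) *: nth 0 (s k.1) k.2.
have b0_fin r : finite_set [set k | b0 r k != 0].
  have := direct_sum_finite r; move/finite_seqP => [t tE].
  have : finite_set [set` [seq (x, k) | x <- t, k <- iota 0 (size (s x))]].
    exact: finite_seq.
  apply: sub_finite_set => -[x k] /=; rewrite /b0 /= => rx0.
  apply/allpairsPdep; exists x, k; split=> //.
    suff : [set` t] x by []; rewrite -tE /=; apply: contra_neq rx0 => ->.
    by rewrite scale0r.
  rewrite mem_iota /= add0n ltnNge; apply: contra_neqN rx0 => le_k.
  by rewrite nth_default // scaler0.
have [b1 b1E] := choice (fun r => ex_direct_sum (b0_fin r)).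
have [a r1 r2|b bE] := @ex_linear R _ _ b1.
  apply: val_inj; apply: funext => k /=; rewrite b1E.
  rewrite -[RHS]/(a *: submod_val (b1 r1) k + submod_val (b1 r2) k) !b1E /b0.
  by rewrite scalerA -scalerDl.
have b_al r : b r = 0 -> al r = 0.
  move=> br0; apply: al0 => x; rewrite gaE; apply: sE => m /(nthP 0)[k lt_k <-].
  have := congr1 (fun g => submod_val g (x, k)) br0.
  by rewrite bE b1E.
have [L LE] := ex_kernel al; have [K KE] := ex_image_submod b L.
have [p [p0 surj_p]] := ex_quot K.
have [de deE] := choice (fun x : N => @ex_delta R N R^o x 1).
have al_de x : al (de x) = x.
  rewrite (al1 _ x) => [|k /negPf kx]; last by rewrite deE kx.
  by rewrite deE eqxx gaE scale1r.
have [a x y|f fE] := @ex_linear R N _ (fun x => p (b (de x))).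
  apply/eqP; rewrite -!linearP -subr_eq0 -!linearB; apply/eqP/p0/KE.
  eexists; last by [].
  by apply/LE; rewrite linearB linearP !al_de subrr.
have inj_f : injective f.
  apply: linear_inj => x; rewrite fE => /p0/KE[r /LE alr br].
  have : al (de x - r) = 0 by apply: b_al; rewrite linearB br subrr.
  by rewrite linearB al_de alr subr0.
have [P PE] := ex_range f.
have [v [inj_v _ vP vS]] := ex_submod_val P.
have [|g gE] := ex_corestrict (i := v) (f := f) inj_v.
  by move=> y; apply/vS/PE; exists y.
exists (quotmod K), P; split; first by exists (N * nat)%type, p.
have /choice[h hE] : forall y, exists x, f x = v y by move=> y; apply/PE/vP.
exists g, h => x.
  by apply: inj_f; rewrite hE gE.
by apply: inj_v; rewrite gE hE.
Qed.

Lemma in_sigma_self : in_sigma M M.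
Proof. by apply/in_sigmaP => x; exists [:: x] => r; apply; rewrite inE. Qed.

Lemma in_sigma_inj X Y (f : {linear X -> Y}) :
  injective f -> in_sigma M Y -> in_sigma M X.
Proof.
move=> inj_f /in_sigmaP locY; apply/in_sigmaP => x.
have [s sE] := locY (f x); exists s => r /sE.
by rewrite -linearZ => /(inj_eq0 inj_f).
Qed.

Lemma locally_subgenerated_map X Y (f : {linear X -> Y}) x :
  locally_subgenerated x -> locally_subgenerated (f x).
Proof. by case=> s sE; exists s => r /sE rx; rewrite -linearZ /= rx linear0. Qed.

Lemma in_sigma_surj X Y (f : {linear X -> Y}) :
  (forall y, exists x, f x = y) -> in_sigma M X -> in_sigma M Y.
Proof.
move=> surj_f /in_sigmaP locX; apply/in_sigmaP => y.
by have [x <-] := surj_f y; apply: locally_subgenerated_map.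
Qed.

Lemma in_sigma_direct_sum (I : choiceType) X :
  in_sigma M X -> in_sigma M (direct_sum I X).
Proof.
move=> /in_sigmaP/choice[s sE]; apply/in_sigmaP => f.
have /finite_seqP[t tE] := direct_sum_finite f.
exists (flatten [seq s (submod_val f i) | i <- t]) => r rs0.
apply: val_inj; apply: funext => i.
rewrite -[LHS]/(r *: submod_val f i) -[RHS]/(0 : X).
have [->|fi0] := eqVneq (submod_val f i) 0; first by rewrite scaler0.
have ti : i \in t by suff : [set` t] i by []; rewrite -tE.
by apply: sE => m sm; apply: rs0; apply/flattenP; exists (s (submod_val f i)) => //;
  apply: map_f.
Qed.

End Sigma.

(** * Divisible groups and characters *)

(** Zorn's lemma for sets above a given one: only nonempty chains have to be
    considered, because [A0] itself bounds the empty one. *)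
Lemma zorn_above (T : Type) (good : set T -> Prop) (A0 : set T) :
  good A0 ->
  (forall F : set (set T), F !=set0 -> (forall A, F A -> good A /\ A0 `<=` A) ->
     total_on F subset -> good (\bigcup_(A in F) A)) ->
  exists A, [/\ A0 `<=` A, good A & forall B, A `<=` B -> good B -> B `<=` A].
Proof.
move=> good0 goodU.
have [F FP Ftot|A [PA maxA]] := @Zorn_bigcup T
    (fun A => A = set0 \/ (good A /\ A0 `<=` A)).
  have [[A [FA A_neq0]]|F0] := pselect (exists A, F A /\ A <> set0); last first.
    left; apply/seteqP; split=> // x [A FA Ax].
    by apply: F0; exists A; split=> // A0'; rewrite A0' in Ax.
  right; have [//|[goodA sA]] := FP _ FA.
  have -> : \bigcup_(B in F) B = \bigcup_(B in [set B | F B /\ B <> set0]) B.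
    apply/seteqP; split=> x [B]; last by case=> FB _ Bx; exists B.
    by move=> FB Bx; exists B => //; split=> // B0; rewrite B0 in Bx.
  split; last by move=> x /sA Ax; exists A.
  apply: goodU; first by exists A.
    by move=> B [/FP[]].
  by move=> B C [FB _] [FC _]; apply: Ftot.
have maxA' B : A `<=` B -> good B -> A0 `<=` B -> B `<=` A.
  move=> AB gB sB; apply: contrapT => nBA.
  by apply: (maxA B); [split|right].
case: PA => [A_0|[gA sA]]; last first.
  by exists A; split=> // B AB gB; apply: maxA' => //; apply: subset_trans AB.
exists A0; split=> // B sB gB x Bx.
suff : A x by rewrite A_0.
by apply: (maxA' B) Bx => // y; rewrite A_0.
Qed.

Section RationalsModZ.

Let Zrat : {pred rat} := [pred x | x \is a Num.int].
Let Zrat_closed : zmod_closed Zrat.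
Proof. by split=> [|x y]; rewrite !inE; [exact: rpred0 | exact: rpredB]. Qed.
HB.instance Definition _ := GRing.isZmodClosed.Build rat Zrat Zrat_closed.

(** The group is Q/Z.  Its torsion serves to find characters: an element of
    order [n] must be sent to an element killed by [n], and [n = 0] stands for
    infinite order. *)
Lemma ex_divisible_group : exists D : zmodType,
  (forall (n : nat) (d : D), (0 < n)%N -> exists e, e *+ n = d) /\
  (forall n : nat, n != 1%N -> exists d : D, d != 0 /\ d *+ n = 0).
Proof.
pose D : zmodType := Quotient.quot Zrat.
pose p : rat -> D := \pi_D.
have pD x y : p (x + y) = p x + p y by exact: Quotient.pi_add.
have p_eq0 x : (p x == 0) = (x \is a Num.int).
  have -> : (0 : D) = p 0 by apply: (addrI (p 0)); rewrite -pD !addr0.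
  by rewrite -[RHS]/(x \in Zrat) -[X in _ = (X \in _)]subr0 Quotient.idealrBE.
have pMn x n : p (x *+ n) = p x *+ n.
  elim: n => [|n IHn]; last by rewrite !mulrS pD IHn.
  by apply/eqP; rewrite mulr0n p_eq0 rpred0.
exists D; split=> [n d n_gt0|n n1].
  exists (p (repr d / n%:R)); rewrite -pMn -mulrnAr -mulr_natr mulVf ?mulr1.
    exact: reprK.
  by rewrite pnatr_eq0 -lt0n.
have [k k_gt1 kn] : exists2 k : nat, (1 < k)%N & (k %| n)%N.
  by case: n n1 => [|[|n]] // _; [exists 2%N | exists n.+2].
have k_neq0 : k%:R != 0 :> rat by rewrite pnatr_eq0 -lt0n ltnW.
(* The class of 1/k for a divisor k > 1 of n; when n = 0 this is 1/2. *)
exists (p k%:R^-1); split.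
  rewrite p_eq0; apply/negP => /intrP[z zE].
  have : (z * k%:Z) = 1.
    by apply: (@intr_inj rat); rewrite rmorphM /= -zE pmulrn mulVf.
  move/(congr1 absz); rewrite abszM /= => /eqP; rewrite muln_eq1 => /andP[_ /eqP k1].
  by rewrite k1 in k_gt1.
have /dvdnP[m ->] := kn.
rewrite -pMn; apply/eqP; rewrite p_eq0 mulnC mulrnA -[_ *+ k]mulr_natr mulVf //.

Qed.
End RationalsModZ.

(** The generator of a subgroup of Z, with [n = 0] for the zero subgroup. *)
Lemma int_subgroup (I : int -> Prop) :
  I 0 -> (forall k l, I k -> I l -> I (k - l)) ->
  exists n : nat, I n /\ forall k, I k -> (n %| k)%Z.
Proof.
move=> I0 IB.
have IN k : I k -> I (- k) by move=> Ik; rewrite -sub0r; apply: IB.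
have ID k l : I k -> I l -> I (k + l).
  by move=> Ik Il; rewrite -[l]opprK; apply/IB/IN.
have Iabs k : I k -> I `|k|%N.
  by case: k => i // /IN; rewrite NegzE opprK.
have [[n n_gt0 In]|noI] := pselect (exists2 n : nat, (0 < n)%N & I n); last first.
  exists 0%N; split=> // k Ik; rewrite dvd0z -absz_eq0 -leqn0 leqNgt.
  by apply/negP => k_gt0; apply: noI; exists `|k|%N => //; apply: Iabs.
have exI : exists n : nat, (0 < n)%N && `[< I n >].
  by exists n; rewrite n_gt0; apply/asboolP.
case: (ex_minnP exI) => m /andP[m_gt0 /asboolP Im] min_m.
have ImZ j : I (j * m%:Z).
  have ImN (i : nat) : I (i%:Z * m%:Z).
    elim: i => [|i IHi]; first by rewrite mul0r.
    by rewrite -addn1 PoszD mulrDl mul1r; apply: ID.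
  case: j => i; first exact: ImN.
  by rewrite NegzE mulNr; apply: IN.
exists m; split=> // k Ik.
have Ir : I (k %% m)%Z by rewrite /modz; apply: IB.
have r_ge0 : 0 <= (k %% m)%Z by rewrite modz_ge0 // -lt0n.
apply/dvdz_mod0P; have [->//|r_neq0] := eqVneq (k %% m)%Z 0.
have := min_m `|(k %% m)%Z|%N.
rewrite absz_gt0 r_neq0 (asboolT (Iabs _ Ir)) => /(_ isT).
rewrite leqNgt -ltz_nat gez0_abs //.
by rewrite ltz_pmod.
Qed.

Section AdditiveExtension.
Variables (B D : zmodType).
Hypothesis divD : forall (n : nat) (d : D), (0 < n)%N -> exists e, e *+ n = d.

(** Partial additive maps from [B] to [D] are handled through their graphs, so
    that extension is inclusion and Zorn's lemma applies to sets. *)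
Definition additive_graph (G : set (B * D)) : Prop :=
  [/\ G 0, forall u v, G u -> G v -> G (u - v) & forall d, G (0, d) -> d = 0].

(** The multiples of [b] in the domain form the multiples of some [n0 b].  The
    value [d] at [b] has to satisfy [n0 d = d0], where [d0] is the value
    prescribed at [n0 b]: divisibility provides it. *)
Lemma additive_graph_step (G : set (B * D)) (b : B) : additive_graph G ->
  exists G', [/\ G `<=` G', additive_graph G' & exists d, G' (b, d)].
Proof.
move=> [G0 GB G1].
have GN u : G u -> G (- u) by move=> Gu; rewrite -sub0r; apply: GB.
have GD u v : G u -> G v -> G (u + v).
  by move=> Gu Gv; rewrite -[v]opprK; apply/GB/GN.
have GZ u k : G u -> G (u *~ k).
  have GMn v (i : nat) : G v -> G (v *+ i).
    by move=> Gv; elim: i => [|i IHi]; rewrite ?mulr0n // mulrS; apply: GD.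
  by move=> Gu; case: k => i; [exact: GMn | apply/GN/GMn].
have Gfun x d e : G (x, d) -> G (x, e) -> d = e.
  move=> Gd Ge; apply/eqP; rewrite -subr_eq0; apply/eqP/G1.
  by have := GB _ _ Gd Ge; rewrite -[_ - _]/(x - x, d - e) subrr.
have Zpair x d k : (x, d) *~ k = (x *~ k, d *~ k) :> B * D.
  have Npair i : (x, d) *+ i = (x *+ i, d *+ i) :> B * D.
    by elim: i => // i IHi; rewrite !mulrS IHi.
  case: k => i; first exact: Npair.
  by rewrite -[LHS]/(- ((x, d) *+ i.+1)) Npair.
have [|k l [d Gk] [e Gl]|n [[d0 Gn] nP]] := @int_subgroup (fun k => exists d, G (b *~ k, d)).
- by exists 0; rewrite mulr0z.
- by exists (d - e); rewrite mulrzBr; apply: (GB _ _ Gk Gl).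
have [d dP] : exists d, forall k y, G (b *~ k, y) -> y = d *~ k.
  have [n0|n_gt0] := posnP n.
    exists 0 => k y Gk; have := nP _ (ex_intro _ _ Gk).
    rewrite n0 dvd0z => /eqP k0; rewrite k0 mulr0z in Gk *.
    exact: G1.
  have [d dn] := divD d0 n_gt0.
  exists d => k y Gk; have /dvdzP[q kE] := nP _ (ex_intro _ _ Gk).
  apply: Gfun Gk _.
  rewrite kE mulrC !mulrzA -[d *~ _]/(d *+ n) dn -Zpair.
  exact: GZ.
pose G' (u : B * D) := exists k, G (u - (b, d) *~ k).
exists G'; split.
- by move=> u Gu; exists 0; rewrite mulr0z subr0.
- split.
  + by exists 0; rewrite mulr0z subr0.
  + move=> u v [k Gk] [l Gl]; exists (k - l).
    have := GB _ _ Gk Gl; congr (G _).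
    by rewrite mulrzBr !opprB addrACA [RHS]addrA addrAC -!addrA; congr (_ + _); rewrite addrC addrA.
  + move=> e [k]; rewrite Zpair => Gk.
    have /GN : G (0 - b *~ k, e - d *~ k) by [].
    rewrite -[- _]/(- (0 - b *~ k), - (e - d *~ k)) sub0r opprK => /dP.
    rewrite opprB => dk; apply: oppr_inj; apply: (addrI (d *~ k)).
    by rewrite dk oppr0 addr0.
- by exists d, 1; rewrite subrr.
Qed.

Lemma additive_extension (G : set (B * D)) : additive_graph G ->
  exists h : B -> D, {morph h : x y / x + y} /\ forall b d, G (b, d) -> h b = d.
Proof.
move=> gG; have [//|F [A0 FA0] FP Ftot|A [sGA [A0 AB A1] maxA]] := @zorn_above _ additive_graph G.
  have FG A : F A -> additive_graph A by move=> /FP[].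
  split.
  - by exists A0 => //; have [] := FG _ FA0.
  - move=> u v [A FA Au] [C FC Cv].
    have [AC|CA] := Ftot _ _ FA FC.
      by exists C => //; have [_ + _] := FG _ FC; apply=> //; apply: AC.
    by exists A => //; have [_ + _] := FG _ FA; apply=> //; apply: CA.
  - by move=> d [A FA Ad]; have [_ _ +] := FG _ FA; apply.
have Atot b : exists d, A (b, d).
  have [|A' [AA' gA' [d A'd]]] := @additive_graph_step A b; first by [].
  by exists d; apply: (maxA A').
have Afun x d e : A (x, d) -> A (x, e) -> d = e.
  move=> Gd Ge; apply/eqP; rewrite -subr_eq0; apply/eqP/A1.
  by have := AB _ _ Gd Ge; rewrite -[_ - _]/(x - x, d - e) subrr.
have [h hE] := choice Atot.
exists h; split=> [x y|b d /sGA Ab]; last exact: Afun (hE b) Ab.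
apply: Afun (hE _) _.
have AN u : A u -> A (- u) by move=> Au; rewrite -sub0r; apply: AB.
by have := AB _ _ (hE x) (AN _ (hE y)); rewrite opprK.
Qed.

End AdditiveExtension.

(** Extend to [X] the map from the subgroup generated by [x] that sends [x] to
    a nonzero element killed by the order of [x]. *)
Lemma ex_character (X D : zmodType) (x : X) :
  (forall (n : nat) (d : D), (0 < n)%N -> exists e, e *+ n = d) ->
  (forall n : nat, n != 1%N -> exists d : D, d != 0 /\ d *+ n = 0) ->
  x != 0 -> exists h : X -> D, {morph h : y z / y + z} /\ h x != 0.
Proof.
move=> divD torD x0.
have [//|k l xk xl|n [xn nP]] := @int_subgroup (fun k => x *~ k = 0).
  by rewrite mulrzBr xk xl subr0.
have [|d [d0 dn]] := torD n; first by apply: contra_neqN x0 => /eqP n1; rewrite n1 in xn.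
pose G (u : X * D) := exists k, u = (x *~ k, d *~ k).
have [|h [hD hE]] := @additive_extension X D divD G.
  split.
  - by exists 0; rewrite !mulr0z.
  - by move=> _ _ [k ->] [l ->]; exists (k - l); rewrite !mulrzBr.
  - move=> e [k [xk ->]].
    have /dvdzP[q ->] := nP _ (esym xk).
    by rewrite mulrC mulrzA -[d *~ _]/(d *+ n) dn mul0rz.
by exists h; split=> //; rewrite (hE x d) //; exists 1.
Qed.

(** * Enough injective modules *)

Section Coinduced.
Variables (R : pzRingType) (J : Type) (D : zmodType).

(** The product over [J] of copies of the coinduced module Hom_Z(R, D), on which
    [a] acts by right translation, [(a q)(j, r) = q(j, r a)]. *)
Definition coind_pred : {pred J -> R -> D} :=
  [pred q | `[< forall j, {morph q j : r s / r + s} >]].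

Let coind_zmod_closed : zmod_closed coind_pred.
Proof.
have pE q : (q \in coind_pred) = `[< forall j, {morph q j : r s / r + s} >] by [].
split=> [|q1 q2]; rewrite !pE.
  by apply/asboolP => j r s; rewrite [RHS]addr0.
move=> /asboolP q1D /asboolP q2D; apply/asboolP => j r s.
by rewrite -![(q1 - q2) j _]/(q1 j _ - q2 j _) q1D q2D opprD addrACA.
Qed.
HB.instance Definition _ :=
  GRing.isZmodClosed.Build (J -> R -> D) coind_pred coind_zmod_closed.

Record coind := Coind { coind_val :> J -> R -> D; _ : coind_val \in coind_pred }.

HB.instance Definition _ := [isSub for coind_val].
HB.instance Definition _ := [Choice of coind by <:].
HB.instance Definition _ := [SubChoice_isSubZmodule of coind by <:].

Lemma coindD (q : coind) j : {morph q j : r s / r + s}.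
Proof. by case: q => q /= /asboolP. Qed.

Fact coind_scale_subproof (a : R) (q : coind) :
  (fun j r => q j (r * a)) \in coind_pred.
Proof. by apply/asboolP => j r s; rewrite mulrDl coindD. Qed.

Definition coind_scale (a : R) (q : coind) : coind :=
  Coind (coind_scale_subproof a q).

Let coind_ext (p q : coind) : (forall j r, p j r = q j r) -> p = q.
Proof. by move=> pq; apply: val_inj; apply: funext => j; apply: funext. Qed.

Let scaleA a b q : coind_scale a (coind_scale b q) = coind_scale (a * b) q.
Proof. by apply: coind_ext => j r /=; rewrite mulrA. Qed.
Let scale1 : left_id 1 coind_scale.
Proof. by move=> q; apply: coind_ext => j r /=; rewrite mulr1. Qed.
Let scaleDr : right_distributive coind_scale +%R.
Proof. by move=> a p q; apply: coind_ext. Qed.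
Let scaleDl q : {morph coind_scale^~ q : a b / a + b}.
Proof.
move=> a b; apply: coind_ext => j r /=.
by rewrite mulrDr coindD.
Qed.

HB.instance Definition _ :=
  GRing.Zmodule_isLmodule.Build R coind scaleA scale1 scaleDr scaleDl.

Lemma ex_coind (X : lmodType R) (h : J -> X -> D) :
  (forall j, {morph h j : x y / x + y}) ->
  exists f : {linear X -> coind}, forall x j r, f x j r = h j (r *: x).
Proof.
move=> hD.
have Ph x : (fun j (r : R) => h j (r *: x)) \in coind_pred.
  by apply/asboolP => j r s; rewrite scalerDl hD.
have [a x y|f fE] := @ex_linear R X coind (fun x => Coind (Ph x)).
  apply: coind_ext => j r.
  rewrite -[RHS]/(h j ((r * a) *: x) + h j (r *: y)) /=.
  by rewrite scalerDr scalerA hD.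
by exists f => x j r; rewrite fE.
Qed.

(** By adjunction a linear map into the product is a family of additive maps to
    [D], recovered by evaluation at 1; these extend because [D] is
    divisible. *)
Lemma coind_injective (A B : lmodType R) (i : {linear A -> B})
    (f : {linear A -> coind}) :
  (forall (n : nat) (d : D), (0 < n)%N -> exists e, e *+ n = d) ->
  injective i -> exists g : {linear B -> coind}, forall a, g (i a) = f a.
Proof.
move=> divD inj_i.
have /choice[h hP] (j : J) : exists h : B -> D,
    {morph h : x y / x + y} /\ forall a, h (i a) = f a j 1.
  pose G (u : B * D) := exists a, u = (i a, f a j 1).
  have [|h [hD hE]] := @additive_extension B D divD G.
    split.
    - by exists 0; rewrite !linear0.
    - move=> _ _ [a1 ->] [a2 ->]; exists (a1 - a2); rewrite !linearB.
      by [].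
    - move=> d [a [/esym/(inj_eq0 inj_i) -> ->]].
      by rewrite linear0.
  by exists h; split=> // a; apply: hE; exists a.
have [|g gE] := @ex_coind B h; first by move=> j; have [] := hP j.
exists g => a; apply: coind_ext => j r; rewrite gE -linearZ.
have [_ ->] := hP j.
by rewrite linearZ /= mul1r.
Qed.

End Coinduced.

(** The product is indexed by [X] itself: the coordinate [x] uses a character
    that does not vanish at [x]. *)
Lemma ex_injective_module (R : pzRingType) (X : lmodType R) :
  exists (Q : lmodType R) (e : {linear X -> Q}), injective e /\
    forall (A B : lmodType R) (i : {linear A -> B}) (f : {linear A -> Q}),
      injective i -> exists g : {linear B -> Q}, forall a, g (i a) = f a.
Proof.
have [D [divD torD]] := ex_divisible_group.
have /choice[h hP] (x : X) : exists h : X -> D,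
    {morph h : y z / y + z} /\ (x != 0 -> h x != 0).
  have [->|x0] := eqVneq x 0; last first.
    by have [h [hD hx]] := ex_character divD torD x0; exists h.
  by exists (fun=> 0); split=> [y z|/eqP//]; rewrite addr0.
have [|e eE] := @ex_coind R X D X h; first by move=> x; have [] := hP x.
exists (coind R X D), e; split; last first.
  by move=> A B i f; apply: coind_injective.
apply: linear_inj => x ex0; apply/eqP/negPn/negP => x0.
have [_ /(_ x0)] := hP x; rewrite -[in h x x](scale1r x) -eE ex0.
by rewrite eqxx.
Qed.

(** * Injective hulls in sigma[M] and the torsion theories chi(X) *)

Section EnoughInjectives.
Variables (R : pzRingType) (M : lmodType R).
Implicit Types X Y E N : lmodType R.

(** The largest submodule of an injective module that belongs to sigma[M] is
    injective in sigma[M], since images of modules of sigma[M] stay inside it.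
    *)
Lemma ex_injective_in_sigma X : in_sigma M X ->
  exists E (e : {linear X -> E}), injective_in_sigma M E /\ injective e.
Proof.
move=> /in_sigmaP locX.
have [Q [e [inj_e injQ]]] := ex_injective_module X.
have [||T TE] := @ex_submod _ Q (@locally_subgenerated R M Q).
- by exists [::] => r _; rewrite scaler0.
- move=> a x y [s sE] [t tE]; exists ([seq a *: m | m <- s] ++ t) => r rst.
  rewrite scalerDr scalerA sE ?tE ?addr0 // => m m_in.
    by apply: rst; rewrite mem_cat m_in orbT.
  rewrite -scalerA; apply: rst; rewrite mem_cat; apply/orP; left.
  exact: map_f.
have [i [inj_i _ iT iS]] := ex_submod_val T.
have [|e' e'E] := @ex_corestrict R _ _ _ i e inj_i.
  by move=> x; apply/iS/TE/locally_subgenerated_map.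
exists (submod T), e'; split; last by move=> x y /(congr1 i); rewrite !e'E => /inj_e.
split=> [|A B j h _ /in_sigmaP locB inj_j].
  apply/in_sigmaP => x; have /TE[s sE] := iT x.
  by exists s => r /sE; rewrite -linearZ => /(inj_eq0 inj_i).
have [g gE] := injQ A B j (i \o h) inj_j.
have [|g' g'E] := @ex_corestrict R _ _ _ i g inj_i.
  by move=> b; apply/iS/TE/locally_subgenerated_map.
by exists g' => a; apply: inj_i; rewrite /= g'E gE.
Qed.

(** Restricting to properties tested on single elements makes the union of a
    chain automatic.  Both uses below are of this kind: essential extensions
    and complements. *)
Lemma zorn_submod X (K : submodClosed X) (Q : X -> Prop) :
  (forall x, x \in K -> Q x) ->
  exists H : submodClosed X, [/\ {subset K <= H}, forall x, x \in H -> Q x &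
    forall H' : submodClosed X, {subset H <= H'} ->
      (forall x, x \in H' -> Q x) -> {subset H' <= H}].
Proof.
move=> KQ.
pose good (S : set X) := [/\ S 0, forall a x y, S x -> S y -> S (a *: x + y)
  & S `<=` Q].
have [|F [A0 FA0] FP Ftot|A [sKA [A0 AD AQ] maxA]] :=
  @zorn_above _ good [set x | x \in K].
- by split=> [|a x y|x] /=; [exact: rpred0 | by move=> *; rewrite rpredD ?rpredZ | exact: KQ].
- split.
  + by exists A0 => //; have [[]] := FP _ FA0.
  + move=> a x y [B FB Bx] [C FC Cy].
    have [BC|CB] := Ftot _ _ FB FC.
      by exists C => //; have [[_ + _] _] := FP _ FC; apply=> //; apply: BC.
    by exists B => //; have [[_ + _] _] := FP _ FB; apply=> //; apply: CB.
  + by move=> x [B /FP[[_ _ BQ] _] /BQ].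
have [H HE] := ex_submod A0 AD.
exists H; split=> [x Kx|x /HE /AQ //|H' sHH' H'Q x H'x]; first by apply/HE/sKA.
apply/HE; apply: (maxA [set x | x \in H']) H'x => [y /HE/sHH' //|].
by split=> [|a y z|] //=; [exact: rpred0 | move=> *; rewrite rpredD ?rpredZ].
Qed.

Lemma essentialP X E (e : {linear X -> E}) :
  essential e <->
  forall y, y != 0 -> exists r x, r *: y = e x /\ e x != 0.
Proof.
split=> [ess_e y y0|ess_e K [y Ky y0]]; last first.
  by have [r [x [ryx ex0]]] := ess_e y y0; exists x; rewrite -ryx rpredZ // ryx.
have [||K KE] := @ex_submod _ _ (fun z => exists r : R, r *: y = z).
- by exists 0; rewrite scale0r.
- by move=> a _ _ [r <-] [s <-]; exists (a * r + s); rewrite scalerDl scalerA.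
have [|x [/KE[r ryx] ex0]] := ess_e K; last by exists r, x.
by exists y => //; apply/KE; exists 1; rewrite scale1r.
Qed.

(** A maximal essential extension [H] of the image of [e] inside [E] is a
    direct summand, here given by the projection [rho].  If [C] is a maximal
    submodule with [H] and [C] independent, then [H] is essential in [E/C], so
    the inclusion of [H] extends to a map [g : E/C -> E] whose image is an
    essential extension of [H], and thus equal to [H].  Then [rho] is the
    composite of [g] with the quotient map. *)
Lemma ex_essential_retract X E (e : {linear X -> E}) : injective_in_sigma M E ->
  exists rho : {linear E -> E}, [/\ forall x, rho (e x) = e x,
    forall y, rho (rho y) = rho y &
    forall y, rho y != 0 -> exists r x, r *: rho y = e x /\ e x != 0].
Proof.
move=> [sE injE].
pose Q y := y != 0 -> exists r x, r *: y = e x /\ e x != 0.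
have [K KE] := ex_range e.
have [x /KE[x' <-] ex0|H [sKH HQ maxH]] := @zorn_submod E K Q.
  by exists 1, x'; rewrite scale1r.
have [x|C [_ CH maxC]] := @zorn_submod E (@zero_submod R E) (fun y => y \in H -> y = 0).
  by move=> /eqP.
have [p [p0 surj_p]] := ex_quot C.
have [i [inj_i _ iH iS]] := ex_submod_val H.
have inj_pi : injective (p \o i).
  by apply: linear_inj => y /p0/CH/(_ (iH _))/(inj_eq0 inj_i).
have [||g gE] := injE _ _ (p \o i) i _ _ inj_pi.
- exact: in_sigma_inj inj_i sE.
- exact: in_sigma_surj surj_p sE.
have gp y : y \in H -> g (p y) = y.
  by move=> /iS[z <-]; rewrite -[RHS]gE.
(* The image of H is essential in E/C, by maximality of C. *)
have ess_p y : p y != 0 -> exists r h, [/\ h \in H, h != 0 & r *: p y = p h].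
  move=> py0; apply: contrapT => noh.
  have [||C' C'E] := @ex_submod _ E (fun z => exists c r, c \in C /\ z = c + r *: y).
  - by exists 0, 0; rewrite rpred0 scale0r addr0.
  - move=> a _ _ [c1 [r1 [Cc1 ->]]] [c2 [r2 [Cc2 ->]]].
    exists (a *: c1 + c2), (a * r1 + r2); rewrite rpredD ?rpredZ //; split=> //.
    by rewrite scalerDr scalerA scalerDl addrACA.
  have /eqP := py0; apply; apply/p0; apply: (maxC C').
  - by move=> c Cc; apply/C'E; exists c, 0; rewrite scale0r addr0.
  - move=> h /C'E[c [r [Cc hE]]] Hh; apply/eqP/negPn/negP => h0.
    apply: noh; exists r, h; split=> //.
    by rewrite hE linearD linearZ /=; have /p0 -> := Cc; rewrite add0r.
  - by apply/C'E; exists 0, 1; rewrite rpred0 scale1r add0r.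
have [G GE] := ex_range g.
have GH : {subset G <= H}.
  apply: maxH => [h Hh|z /GE[y <-] gy0].
    by apply/GE; exists (p h); apply: gp.
  have [y' yE] := surj_p y; rewrite -{}yE in gy0 *.
  have [|r [h [Hh h0 ryh]]] := ess_p y'.
    by apply: contra_neq gy0 => ->; rewrite linear0.
  have [s [x [sx ex0]]] := HQ _ Hh h0.
  by exists (s * r), x; rewrite -scalerA -linearZ ryh gp.
have gH y : g (p y) \in H by apply/GH/GE; exists (p y).
exists (g \o p); split=> [x|y|y] /=; last exact: HQ.
  by apply/gp/sKH/KE; exists x.
exact: gp.
Qed.

Lemma retract_injective E (rho : {linear E -> E}) : injective_in_sigma M E ->
  (forall y, rho (rho y) = rho y) ->
  exists (H : lmodType R) (i : {linear H -> E}) (q : {linear E -> H}),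
    [/\ injective_in_sigma M H, injective i, forall y, i (q y) = rho y &
        forall h, q (i h) = h].
Proof.
move=> [sE injE] rhoK.
have [H [q [i [inj_i iq surj_q]]]] := ex_image rho.
have qi h : q (i h) = h.
  by have [y <-] := surj_q h; apply: inj_i; rewrite !iq rhoK.
exists H, i, q; split=> //; split; first exact: in_sigma_inj inj_i sE.
move=> A B j h sA sB inj_j.
have [g gE] := injE _ _ j (i \o h) sA sB inj_j.
by exists (q \o g) => a; rewrite /= -[in LHS]/((g \o j) a) gE /= qi.
Qed.

Lemma ex_injective_hull X : in_sigma M X ->
  exists E (e : {linear X -> E}), injective_hull_in_sigma M e.
Proof.
move=> sX; have [E [e [injE inj_e]]] := ex_injective_in_sigma sX.
have [rho [rho_e rhoK ess_rho]] := ex_essential_retract e injE.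
have [H [i [q [injH inj_i iq qi]]]] := retract_injective injE rhoK.
exists H, (q \o e); split=> //.
  by apply: linear_inj => x /(congr1 i); rewrite /= iq rho_e linear0 => /(inj_eq0 inj_e).
apply/essentialP => y y0.
have iy0 : rho (i y) != 0.
  by rewrite -iq qi; apply: contra_neq y0; apply: inj_eq0.
have [r [x [rx ex0]]] := ess_rho _ iy0.
exists r, x; split; last first.
  apply: contra_neq ex0 => /(congr1 i); rewrite /= iq rho_e linear0 //.
by apply: inj_i; rewrite /= iq rho_e -rx linearZ -iq qi.
Qed.

(** A submodule of [N] is represented by an injection, so that the notion
    composes with arbitrary injections without transport. *)
Definition has_partial_map N X : Prop :=
  exists (A : lmodType R) (j : {linear A -> N}) (f : {linear A -> X}),
    injective j /\ exists a, f a != 0.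

(** A nonzero map from a submodule of [N] to [X] extends to a nonzero map from
    [N] to the hull of [X]; conversely a nonzero map from [N] to the hull has an
    image that meets [X], and is restricted to the preimage of [X]. *)
Lemma chiP X N : in_sigma M X -> chi M X N <-> in_sigma M N /\ ~ has_partial_map N X.
Proof.
move=> sX; split=> [[sN [E [e [[injE inj_e ess_e] N0]]]]|[sN N0]]; split=> //.
  move=> [A [j [f [inj_j [a fa0]]]]].
  have [_ /(_ A N j (e \o f) (in_sigma_inj inj_j sN) sN inj_j)[g gE]] := injE.
  have := gE a; rewrite /= N0 => /esym/(inj_eq0 inj_e)/eqP.
  by rewrite (negPf fa0).
have [E [e hull_e]] := ex_injective_hull sX.
exists E, e; split=> // f x; apply/eqP/negPn/negP => fx0; apply: N0.
have [_ inj_e /essentialP ess_e] := hull_e.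
have [A [j [h [inj_j hE jh]]]] := ex_pullback f inj_e.
have [r [y [ry ey0]]] := ess_e _ fx0.
exists A, j, h; split=> //; have [|a _ ha] := jh (r *: x) y; first by rewrite linearZ.
by exists a; rewrite ha; apply: contra_neq ey0 => ->; rewrite linear0.
Qed.

Lemma eq_chi X Y : in_sigma M X -> in_sigma M Y ->
  (forall N, in_sigma M N -> has_partial_map N X <-> has_partial_map N Y) -> chi M X = chi M Y.
Proof.
move=> sX sY XY; apply: funext => N; apply: propext.
by rewrite !chiP //; split=> -[sN nN]; split=> //; move: nN; rewrite XY.
Qed.

End EnoughInjectives.

(** * Uniform submodules of a semiprime projective module *)

Lemma submod_prodP (R : pzRingType) (M : lmodType R) (K L N : submodClosed M) :
  submod_prod K L `<=` [set` N] <->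
  forall (f : {linear M -> submod L}) x, x \in K -> submod_val (f x) \in N.
Proof.
split=> [KLN f x Kx|KLN _ [n [f [k [Kk ->]]]]]; last first.
  by apply: rpred_sum => i _; apply: KLN.
apply: KLN; exists 1%N, (fun=> f), (fun=> x); split=> //.
by rewrite big_ord_recl big_ord0 addr0.
Qed.

Lemma uniform_inj (R : pzRingType) (U W : lmodType R) (e : {linear W -> U}) :
  injective e -> (exists w : W, w != 0) -> uniform U -> uniform W.
Proof.
move=> inj_e W0 [_ uniU]; split=> // K L [k Kk k0] [l Ll l0].
have [eK eKE] := ex_image_submod e K; have [eL eLE] := ex_image_submod e L.
have e0 w : w != 0 -> e w != 0 by apply: contra_neq; apply: inj_eq0.
have [||_ [/eKE[w Kw <-] /eLE[w' Lw' /inj_e ww'] ew0]] := uniU eK eL.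
- by exists (e k); [apply/eKE; exists k | apply: e0].
- by exists (e l); [apply/eLE; exists l | apply: e0].
exists w; split=> //; first by rewrite -ww'.
by apply: contra_neq ew0 => ->; rewrite linear0.
Qed.

(** A nonempty family without maximal member yields, by iterated choice, a
    strictly increasing sequence. *)
Lemma acc_maximal (R : pzRingType) (M : lmodType R) (Q : set M -> Prop) :
  acc_on_annihilators M -> (exists A, Q A) ->
  (forall A, Q A -> range (@annihilator R M) A) ->
  exists2 A, Q A & forall B, Q B -> A `<=` B -> B `<=` A.
Proof.
move=> acc [A0 QA0] Qann; apply: contrapT => nomax.
have /choice[next nextP] (A : set M) :
    exists B, Q A -> [/\ Q B, A `<=` B & ~ B `<=` A].
  have [QA|nQA] := pselect (Q A); last by exists A.
  apply: contrapT => noB; apply: nomax; exists A => // B QB AB.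
  by apply: contrapT => nBA; apply: noB; exists B.
pose A n := iter n next A0.
have QA n : Q (A n) by elim: n => //= n /nextP[].
have AS n : [/\ A n `<=` A n.+1 & ~ A n.+1 `<=` A n].
  by have [_ ? ?] := nextP _ (QA n).
have [n nP] := acc A (fun n => Qann _ (QA n)) (fun n => (AS n).1).
by have [_] := AS n; apply; rewrite nP.
Qed.

Section SemiprimeProjective.
Variables (R : pzRingType) (M : lmodType R).
Hypothesis projM : projective_in_sigma M M.
Implicit Types N U W E A : lmodType R.

Lemma projective_lift N A (p : {linear N -> A}) (w : {linear M -> A}) :
  in_sigma M N -> (forall a, exists n, p n = a) ->
  exists v : {linear M -> N}, forall x, p (v x) = w x.
Proof.
move=> sN surj_p.
have [K KE] := ex_kernel p.
have [i [inj_i _ iK iS]] := ex_submod_val K.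
have sK := in_sigma_inj inj_i sN.
have sA := in_sigma_surj surj_p sN.
have [|_ _ /(_ w)[v vE]] := projM sK sN sA (f := i) (g := p).
  split=> // n; split=> [pn0|[k <-]]; last by apply/KE.
  by apply/iS/KE.
by exists v.
Qed.

(** [T] is the sum of the submodules [f (j N)], obtained as the least submodule
    containing them.  It is covered by a direct sum of copies of [N] indexed by
    End(M); a map [M -> T] lifts to that sum by projectivity, and the
    components of the lift are maps [M -> N].  So an element of [M] killed by
    every map to [N] is killed by every map to [T]. *)
Lemma ex_invariant_span N (j : {linear N -> M}) : in_sigma M N ->
  exists T : submodClosed M, [/\ fully_invariant T, forall n, j n \in T,
    forall K : submodClosed M,
      (forall (f : {linear M -> M}) n, f (j n) \in K) -> {subset T <= K} &
    forall x, (forall h : {linear M -> N}, h x = 0) ->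
      forall h : {linear M -> submod T}, h x = 0].
Proof.
move=> sN.
have [||T TE] := @ex_submod _ M (fun y => forall K : submodClosed M,
    (forall (f : {linear M -> M}) n, f (j n) \in K) -> y \in K).
- by move=> K _; apply: rpred0.
- by move=> a x y xT yT K KP; rewrite rpredD ?rpredZ ?xT ?yT.
have Tj (f : {linear M -> M}) n : f (j n) \in T by apply/TE => K; apply.
exists T; split=> [f y /TE yT|n|K KP y /TE|x xN w].
- have [K KE] := ex_preimage f T.
  by apply/KE/yT => g n; apply/KE; apply: (Tj (f \o g)).
- exact: (Tj idfun).
- exact.
pose I : choiceType := {classic {linear M -> M}}.
have [D [D0 D1]] := @ex_direct_sum_map R I N M (fun f => (f : {linear M -> M}) \o j).
have [i [inj_i _ iT _]] := ex_submod_val T.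
have [A [k [h [inj_k hE hS]]]] := ex_pullback D inj_i.
have surj_h t : exists a, h a = t.
  have [K KE] := ex_range D.
  have [d De] : exists d : direct_sum I N, D d = i t.
    apply/KE; have /TE := iT t; apply=> f n; apply/KE.
    have [d dE] := @ex_delta R I N f n.
    exists d; rewrite (D1 _ f) ?dE ?eqxx // => l /negPf lf.
    by rewrite dE lf.
  by have [a _ ha] := hS _ _ De; exists a.
have [|v vE] := projective_lift w _ surj_h.
  by apply: in_sigma_inj inj_k _; apply: in_sigma_direct_sum.
apply: (inj_eq0 inj_i); rewrite -vE hE; apply: D0 => f /=.
have [a d1 d2|pr prE] := @ex_linear R (direct_sum I N) N (fun d => submod_val d f).
  by [].
by rewrite -prE -[pr _]/((pr \o k \o v) x) xN !linear0.
Qed.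

Hypothesis semiM : semiprime_module M.

(** Otherwise every map [M -> N] would vanish on [j N], hence every map
    from [M] to the invariant span [T] of [j N] would vanish on [T], and
    semiprimeness would force [T = 0]. *)
Lemma ex_map_nonzero N (j : {linear N -> M}) : injective j ->
  (exists n : N, n != 0) -> exists (h : {linear M -> N}) n, h (j n) != 0.
Proof.
move=> inj_j [n n0]; apply: contrapT => noh.
have hj0 (h : {linear M -> N}) k : h (j k) = 0.
  by apply/eqP/negPn/negP => hk; apply: noh; exists h, k.
have [T [invT Tj Tmin Tkill]] := ex_invariant_span j (in_sigma_inj inj_j (in_sigma_self M)).
have [_ _ /(_ T invT) semiT] := semiM.
have wT (w : {linear M -> submod T}) k : k \in T -> w k = 0.
  have [K KE] := ex_kernel w.
  move=> Tk; apply/KE; apply: Tmin Tk => f m; apply/KE.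
  by rewrite -[w _]/((w \o f) (j m)) Tkill.
have /eqP jn0 : j n \in @zero_submod R M.
  apply: semiT (Tj n).
  by apply/submod_prodP => w k Tk; rewrite wT // rpred0.
by rewrite (inj_eq0 inj_j jn0) eqxx in n0.
Qed.

Hypothesis accM : acc_on_annihilators M.

(** Choose [f : M -> U] nonzero on [U] with maximal kernel, let [W] be the image
    of [U] under it and let [g : M -> W] be nonzero on [W].  The composite of
    [f] and [g] is again nonzero on [U], so by maximality its kernel is that
    of [f], that is, [g] is injective on the image of [f].  Then
    [g] is injective on the nonzero submodule [W], and hence on the uniform
    module [U]. *)
Lemma uniform_ex_map_inj U (u : {linear U -> M}) : uniform U -> injective u ->
  exists h : {linear M -> U}, injective (h \o u).
Proof.
move=> uniU inj_u; have [U0 meetU] := uniU.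
pose Q (S : set M) := exists f : {linear M -> U}, (exists x, f (u x) != 0) /\
  S = [set y | f y = 0].
have [||_ [f [[x fx0] ->]] maxf] := acc_maximal (Q := Q) accM.
- by have [h [x hx0]] := ex_map_nonzero inj_u U0; exists [set y | h y = 0], h; split=> //; exists x.
- move=> _ [f [_ ->]]; exists [set (u \o f : {linear M -> M})] => //.
  apply/seteqP; split=> y /=; first by move/(_ _ erefl) => /(inj_eq0 inj_u).
  by move=> fy0 _ -> /=; rewrite fy0 linear0.
have [W [p [i [inj_i ip surj_p]]]] := ex_image (f \o u).
have [||g [w gw0]] := @ex_map_nonzero W (u \o i).
- by move=> a b /= /inj_u/inj_i.
- exists (p x); apply: contra_neq fx0 => px0.
  by rewrite -[f _]/((f \o u) x) -ip px0 linear0.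
(* Maximality of the kernel of f against the composite M -> U -> W -> U. *)
have gf y : g (u (f y)) = 0 -> f y = 0.
  move: y; apply: (maxf [set y | g (u (f y)) = 0]) => [|y /= ->]; last by rewrite !linear0.
  exists (i \o g \o u \o f); split; last first.
    by apply/seteqP; split=> y /=; [move=> ->; rewrite linear0 | move/(inj_eq0 inj_i)].
  have [y yw] := surj_p w; exists y => /=.
  rewrite -[f (u y)]/((f \o u) y) -ip yw.
  by apply: contra_neq gw0 => /(inj_eq0 inj_i).
exists (i \o g); apply: linear_inj => z gz0; apply/eqP/negPn/negP => z0.
have [K KE] := ex_kernel (g \o u).
have [L LE] := ex_range i.
have [||z' [/KE gz /LE[w' w'E] z'0]] := meetU K L.
- by exists z => //; apply/KE/(inj_eq0 inj_i).
- by exists (f (u x)) => //; apply/LE; exists (p x); rewrite ip.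
have [y yw] := surj_p w'; move: gz z'0; rewrite -w'E -yw ip => /gf fuy0.
by rewrite /= fuy0 eqxx.
Qed.

Lemma uniform_split U (u : {linear U -> M}) A (f : {linear A -> U}) :
  uniform U -> injective u -> in_sigma M A -> (forall y, exists a, f a = y) ->
  exists s : {linear U -> A}, injective s.
Proof.
move=> uniU inj_u sA surj_f; have [h inj_hu] := uniform_ex_map_inj uniU inj_u.
have [v vE] := projective_lift h sA surj_f.
exists (v \o u) => x y /= vxy; apply: inj_hu.
by rewrite /= -!vE vxy.
Qed.
End SemiprimeProjective.

(** * Minimal primes are the rejects of uniform submodules *)

Section MinimalPrimes.
Variables (R : pzRingType) (M : lmodType R).
Hypotheses (projM : projective_in_sigma M M) (semiM : semiprime_module M).
Hypotheses (accM : acc_on_annihilators M) (unifM : submodules_contain_uniform M).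
Implicit Types N U W E A : lmodType R.

(** Equivalently, the largest submodule [P] with [P_M U = 0]. *)
Definition is_reject U (P : submodClosed M) : Prop :=
  forall x, x \in P <-> forall f : {linear M -> U}, f x = 0.

Lemma ex_reject U : exists P, is_reject U P.
Proof.
apply: ex_submod => [f|a x y Px Py f]; first exact: linear0.
by rewrite linearP Px Py scaler0 addr0.
Qed.

Lemma reject_fully_invariant U P : is_reject U P -> fully_invariant P.
Proof. by move=> PE f x /PE Px; apply/PE => g; apply: (Px (g \o f)). Qed.

Lemma in_sigma_submodule N (j : {linear N -> M}) : injective j -> in_sigma M N.
Proof. by move=> inj_j; apply: in_sigma_inj inj_j (in_sigma_self M). Qed.

Lemma reject_avoids U (u : {linear U -> M}) P x :
  uniform U -> injective u -> is_reject U P -> u x \in P -> x = 0.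
Proof.
move=> uniU inj_u PE /PE Px.
have [h inj_hu] := uniform_ex_map_inj projM semiM accM uniU inj_u.
by apply: (inj_eq0 inj_hu); apply: Px.
Qed.

(** If [K] and [L] are not contained in the reject, some [f(K)] and [g(L)] are
    nonzero in [U], and [V], their intersection, is uniform.  A map [h] from [M]
    to [V] that is injective on [V] lifts along [g] to a map [M -> L], nonzero on
    [V], and [V] lies in [K] by invariance.  So the product of [K] and [L] is
    not contained in the reject. *)
Lemma reject_prime U (u : {linear U -> M}) P :
  uniform U -> injective u -> is_reject U P -> prime_in P.
Proof.
move=> uniU inj_u PE; have [[x0 x00] meetU] := uniU.
split; first exact: reject_fully_invariant PE.
  exists (u x0); apply/negP => /(reject_avoids uniU inj_u PE)/eqP.
  by rewrite (negPf x00).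
move=> K L invK invL /submod_prodP KLP; apply: contrapT => /not_orP[nK nL].
have ex_out (S : submodClosed M) : ~ {subset S <= P} ->
    exists (f : {linear M -> U}) x, x \in S /\ f x != 0.
  move=> nS; apply: contrapT => nof; apply: nS => x Sx; apply/PE => f.
  by apply/eqP/negPn/negP => fx0; apply: nof; exists f, x.
have [f [x [Kx fx0]]] := ex_out K nK; have [g [y [Ly gy0]]] := ex_out L nL.
have [fK fKE] := ex_image_submod f K; have [gL gLE] := ex_image_submod g L.
have [||z [fKz gLz z0]] := meetU fK gL.
- by exists (f x) => //; apply/fKE; exists x.
- by exists (g y) => //; apply/gLE; exists y.
have [V VE] := ex_intersection fK gL.
have [v [inj_v _ vV vS]] := ex_submod_val V.
have [z' z'E] : exists z', v z' = z by apply/vS/VE.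
have uniV : uniform (submod V).
  apply: uniform_inj inj_v _ uniU; exists z'; rewrite -z'E in z0.
  by apply: contra_neq z0 => ->; rewrite linear0.
have inj_uv : injective (u \o v) by move=> a b /= /inj_u/inj_v.
have [h inj_h] := uniform_ex_map_inj projM semiM accM uniV inj_uv.
have [l [inj_l lE lL lS]] := ex_submod_val L.
have [A [i [q [inj_i qE qS]]]] := ex_pullback (g \o l) inj_v.
have surj_q w : exists a, q a = w.
  have /VE[_ /gLE[b Lb gb]] := vV w; have [b' b'E] := lS _ Lb.
  have [|a _ qa] := qS b' w; first by rewrite /= b'E.
  by exists a.
have sA : in_sigma M A by apply: in_sigma_inj inj_i (in_sigma_submodule inj_l).
have [t tE] := projective_lift projM h sA surj_q.
have Kz : u z \in K.
  have /fKE[b Kb <-] := fKz.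
  by apply: (invK (u \o f)).
have := KLP (i \o t) _ Kz; rewrite -lE => /PE/(_ g).
rewrite -[g _]/((g \o l) (i (t (u z)))) -qE tE -z'E => /(inj_eq0 inj_v) hz.
have z'0 : z' = 0 by apply: (inj_eq0 inj_h).
by move: z0; rewrite -z'E z'0 linear0 eqxx.
Qed.

(** With [T] the invariant span of [U], the product of the reject [P] and [T]
    vanishes.  A prime [Q] inside [P] therefore contains [P] or [T]; the latter
    would put [U] inside [P]. *)
Lemma reject_minimal_prime U (u : {linear U -> M}) P :
  uniform U -> injective u -> is_reject U P -> minimal_prime_in P.
Proof.
move=> uniU inj_u PE; split; first exact: reject_prime uniU inj_u PE.
move=> Q [_ _ primeQ] QP.
have [T [invT uT _ Tkill]] := ex_invariant_span projM u (in_sigma_submodule inj_u).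
have [|//|TQ] := primeQ P T (reject_fully_invariant PE) invT.
  by apply/submod_prodP => f x /PE/Tkill ->; rewrite rpred0.
have [[x x0] _] := uniU.
have /(reject_avoids uniU inj_u PE)/eqP : u x \in P by apply/QP/TQ.
by rewrite (negPf x0).
Qed.

(** The intersection of [T] and [P] has zero square: its elements, being in
    [P], are killed by every map from [M] to [T]. *)
Lemma span_reject_trivial N (j : {linear N -> M}) (T P : submodClosed M) :
  is_reject N P -> fully_invariant T ->
  (forall x, (forall h : {linear M -> N}, h x = 0) ->
     forall h : {linear M -> submod T}, h x = 0) ->
  forall x, x \in T -> x \in P -> x = 0.
Proof.
move=> PE invT Tkill.
have [J JE] := ex_intersection T P.
have [_ _ /(_ J) semiJ] := semiM.
move=> x Tx Px; have/eqP -> // : x \in @zero_submod R M.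
have [i [inj_i iE iJ iS]] := ex_submod_val J.
have [t [inj_t tE tT tS]] := ex_submod_val T.
apply: semiJ; last by apply/JE.
  move=> f y /JE[Ty Py]; apply/JE; split; first exact: invT.
  exact: (reject_fully_invariant PE).
apply/submod_prodP => w k /JE[_ /PE/Tkill kT].
have [|g gE] := @ex_corestrict R _ _ _ t (i \o w) inj_t.
  by move=> y; apply: tS; have /JE[] := iJ (w y).
by rewrite -iE -[i _]/((i \o w) k) -gE kT linear0 rpred0.
Qed.

(** Suppose that no reject of a uniform submodule is contained in [P]; by
    minimality this is what has to be refuted.  The fully invariant submodules
    not contained in [P] are then stable under intersection with such
    rejects.  Take [K] among them with the largest annihilator and a uniform
    [V] inside [K]: intersecting [K] with the reject of [V] does not change the
    annihilator, which would then contain [V], whereas some map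
    [M -> V] is injective on [V]. *)
Lemma minimal_prime_reject P : minimal_prime_in P ->
  exists U (u : {linear U -> M}), [/\ uniform U, injective u & is_reject U P].
Proof.
move=> [primeP minP]; have [invP [x0 x0P] PP] := primeP.
apply: contrapT => noU.
have nPU U (u : {linear U -> M}) (Q : submodClosed M) :
    uniform U -> injective u -> is_reject U Q -> ~ {subset Q <= P}.
  move=> uniU inj_u QE QP; apply: noU; exists U, u; split=> // x.
  have PQ := minP _ (reject_prime uniU inj_u QE) QP.
  by rewrite -QE; split; [exact: PQ | exact: QP].
pose ann (K : submodClosed M) : set M :=
  [set x | forall f : {linear M -> M}, (forall y, f y \in K) -> f x = 0].
pose Q (S : set M) := exists K : submodClosed M,
  [/\ fully_invariant K, ~ {subset K <= P} & S = ann K].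
have [||_ [K [invK nKP ->]] maxK] := acc_maximal (Q := Q) accM.
- have [K KE] := ex_kernel (\0 : {linear M -> M}).
  exists (ann K), K; split=> // [f x _|sKP]; first exact/KE.
  by have /negP := x0P; apply; apply/sKP/KE.
- move=> _ [K [_ _ ->]]; by exists [set f | forall y, f y \in K].
have [k Kk k0] : exists2 x, x \in K & x != 0.
  apply: contrapT => K0; apply: nKP => x Kx.
  have [->|x_neq0] := eqVneq x 0; first exact: rpred0.
  by case: K0; exists x.
have [|V VK uniV] := unifM (N := K); first by exists k.
have [u [inj_u _ uV _]] := ex_submod_val V.
have [PV PVE] := ex_reject (submod V).
have [K1 K1E] := ex_intersection K PV.
have invK1 : fully_invariant K1.
  move=> f x /K1E[Kx Px]; apply/K1E; split; first exact: invK.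
  exact: (reject_fully_invariant PVE).
have nK1P : ~ {subset K1 <= P}.
  move=> K1P; have [|//|] := PP K PV invK (reject_fully_invariant PVE); last first.
    exact: nPU uniV inj_u PVE.
  apply/submod_prodP => f x Kx; apply/K1P/K1E.
  have [i [_ iE iPV _]] := ex_submod_val PV.
  by rewrite -iE; split; [exact: (invK (i \o f)) | exact: iPV].
have [T [invT uT _ Tkill]] := ex_invariant_span projM u (in_sigma_submodule inj_u).
have [[z z0] _] := uniV.
have uz_ann : ann K1 (u z).
  move=> f fK1; have /K1E[_ Pfz] := fK1 (u z).
  by apply: (span_reject_trivial u PVE invT Tkill) Pfz; apply: invT.
have {}uz_ann : ann K (u z).
  apply: (maxK (ann K1)) uz_ann; first by exists K1.
  by move=> x xK f fK1; apply: xK => y; have /K1E[] := fK1 y.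
have [h inj_hu] := uniform_ex_map_inj projM semiM accM uniV inj_u.
have /(inj_eq0 inj_u) hz : (u \o h) (u z) = 0 by apply: uz_ann => y; apply/VK/uV.
by move: z0; rewrite (inj_eq0 inj_hu hz) eqxx.
Qed.

(** [U] embeds in [M/P] because it avoids [P], and [M/P] embeds in a
    product of copies of [U]. *)
Lemma chi_quot_reject U (u : {linear U -> M}) P :
  uniform U -> injective u -> is_reject U P -> chi M (quotmod P) = chi M U.
Proof.
move=> uniU inj_u PE; have [p [p0 surj_p]] := ex_quot P.
apply: eq_chi => [||N _].
- exact: in_sigma_surj surj_p (in_sigma_self M).
- exact: in_sigma_submodule inj_u.
split=> [[A [j [f [inj_j [a fa0]]]]]|[A [j [f [inj_j [a fa0]]]]]].
  have [y yE] := surj_p (f a).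
  have [g gy0] : exists g : {linear M -> U}, g y != 0.
    apply: contrapT => nog; move/eqP: fa0; apply; rewrite -yE; apply/p0/PE => g.
    by apply/eqP/negPn/negP => gy0; apply: nog; exists g.
  have [|g' g'E] := ex_factor (f := g) surj_p; first by move=> x /p0/PE.
  by exists A, j, (g' \o f); split=> //; exists a; rewrite /= -yE g'E.
exists A, j, (p \o u \o f); split=> //; exists a => /=.
by apply: contra_neq fa0 => /p0/(reject_avoids uniU inj_u PE).
Qed.

(** A nonzero map to [E] has a nonzero restriction with values in [U]. *)
Lemma chi_essential U E (e : {linear U -> E}) :
  in_sigma M E -> injective e -> essential e -> chi M E = chi M U.
Proof.
move=> sE inj_e /essentialP ess_e; apply: eq_chi => // [|N _].
  exact: in_sigma_inj inj_e sE.
split=> [[A [j [f [inj_j [a fa0]]]]]|[A [j [f [inj_j [a fa0]]]]]]; last first.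
  by exists A, j, (e \o f); split=> //; exists a; apply: contra_neq fa0 => /(inj_eq0 inj_e).
have [B [i [h [inj_i hE hS]]]] := ex_pullback f inj_e.
have [r [x [rx ex0]]] := ess_e _ fa0.
exists B, (j \o i), h; split; first by move=> b c /= /inj_j/inj_i.
have [|b _ hb] := hS (r *: a) x; first by rewrite linearZ.
by exists b; rewrite hb; apply: contra_neq ex0 => ->; rewrite linear0.
Qed.

(** * Indecomposable torsion free injectives *)

(** The maximal essential extension of the image of [W] inside [E] is a nonzero
    direct summand, so it is all of [E]. *)
Lemma indecomposable_essential W E (e : {linear W -> E}) :
  indecomposable E -> injective_in_sigma M E -> (exists w, e w != 0) -> essential e.
Proof.
move=> [_ indE] injE [w ew0].
have [rho [rho_e rhoK ess_rho]] := ex_essential_retract e injE.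
have [||A AE] := @ex_submod _ E (fun y => rho y = y).
- exact: linear0.
- by move=> a x y rx ry; rewrite linearP rx ry.
have [B BE] := ex_kernel rho.
apply/essentialP => y y0.
suff rhoy : rho y = y by rewrite -rhoy in y0 *; apply: ess_rho.
have [x|x /AE rx /BE r0|A0|B0] := indE A B.
- exists (rho x), (x - rho x); split; first exact/AE.
    by apply/BE; rewrite linearB rhoK subrr.
  by rewrite addrC subrK.
- by rewrite -rx.
- by case/eqP: ew0; apply/A0/AE.
apply/eqP; rewrite eq_sym -subr_eq0; apply/eqP/B0/BE.
by rewrite linearB rhoK subrr.
Qed.

(** Extend [W -> E] along [W -> E'] to [phi].  It is injective because [W] is
    essential in [E'], it splits because [E'] is injective, and the splitting is
    injective because [phi] is essential. *)
Lemma indecomposable_iso W E E' (e : {linear W -> E}) (e' : {linear W -> E'}) :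
  (exists w : W, w != 0) -> injective e -> injective e' ->
  indecomposable E -> injective_in_sigma M E ->
  indecomposable E' -> injective_in_sigma M E' -> isomorphic E' E.
Proof.
move=> [w w0] inj_e inj_e' indE injE indE' injE'.
have ne0 (X : lmodType R) (f : {linear W -> X}) : injective f -> exists w, f w != 0.
  by move=> inj_f; exists w; apply: contra_neq w0; apply: inj_eq0.
have ess' := indecomposable_essential indE' injE' (ne0 _ _ inj_e').
have [sE extE] := injE; have [sE' extE'] := injE'.
have [phi phiE] := extE _ _ e' e (in_sigma_inj inj_e' sE') sE' inj_e'.
have inj_phi : injective phi.
  apply: linear_inj => x px0; apply/eqP/negPn/negP => x0.
  have /essentialP/(_ x x0)[r [y [rx ey0]]] := ess'.
  have: e y = 0 by rewrite -phiE /= -rx linearZ /= px0 scaler0.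
  by move/(inj_eq0 inj_e) => y0; rewrite y0 linear0 eqxx in ey0.
have [psi psiE] := extE' _ _ phi idfun sE' sE inj_phi.
have ess_phi : essential phi.
  apply: indecomposable_essential => //; have [y ey0] := ne0 _ _ inj_e.
  by exists (e' y); have := phiE y => /= ->.
exists phi, psi => x; first exact: psiE.
have inj_psi : injective psi.
  apply: linear_inj => y py0; apply/eqP/negPn/negP => y0.
  have /essentialP/(_ y y0)[r [z [ry pz0]]] := ess_phi.
  have: psi (phi z) = z by apply: psiE.
  by rewrite -ry linearZ /= py0 scaler0 => z0; rewrite -z0 linear0 eqxx in pz0.
by apply: inj_psi; apply: psiE.
Qed.

(** Some submodule [A] of [E] has a nonzero map to [M], and the image contains
    a uniform [V].  The preimage of [V] in [A] maps onto [V], so [V] embeds in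
    it. *)
Lemma indecomposable_ex_uniform E :
  indecomposable E -> torsion_free M (chi M M) E -> injective_in_sigma M E ->
  exists U (u : {linear U -> M}) (e : {linear U -> E}),
    [/\ uniform U, injective u, injective e & essential e].
Proof.
move=> indE [sE tfE] injE; have [[x x0] _] := indE.
have [K KE] := ex_kernel (\0 : {linear E -> E}).
have [k [inj_k _ _ _]] := ex_submod_val K.
have : ~ chi M M (submod K).
  by move=> /tfE/(_ x)-/(_ (iffRL (KE x) erefl))/eqP; rewrite (negPf x0).
rewrite chiP; last exact: in_sigma_self.
move=> /not_andP[[]|/contrapT[A [j [f [inj_j [a fa0]]]]]].
  exact: in_sigma_inj inj_k sE.
have [N NE] := ex_range f.
have [|V VN uniV] := unifM (N := N).
  by exists (f a) => //; apply/NE; exists a.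
have [u [inj_u _ uV _]] := ex_submod_val V.
have [B [i [h [inj_i hE hS]]]] := ex_pullback f inj_u.
have surj_h v : exists b, h b = v.
  have /NE[a' fa'] := VN _ (uV v).
  by have [b _ hb] := hS _ _ fa'; exists b.
have inj_kji : injective (k \o j \o i) by move=> b c /= /inj_k/inj_j/inj_i.
have sB := in_sigma_inj inj_kji sE.
have [s inj_s] := uniform_split projM semiM accM uniV inj_u sB surj_h.
have inj_e : injective (k \o j \o i \o s) by move=> b c /inj_kji/inj_s.
exists (submod V), u, (k \o j \o i \o s); split=> //.
apply: indecomposable_essential => //; have [[v v0] _] := uniV.
by exists v; apply: contra_neq v0; apply: inj_eq0.
Qed.

(** Every nonzero submodule of the hull [E] meets [U] in a nonzero submodule,
    which embeds in [M]; and two nonzero submodules of [E] meet inside [U]. *)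
Lemma uniform_hull U (u : {linear U -> M}) : uniform U -> injective u ->
  exists E (e : {linear U -> E}), [/\ indecomposable E,
    torsion_free M (chi M M) E, injective_in_sigma M E, injective e & essential e].
Proof.
move=> uniU inj_u; have [[x x0] meetU] := uniU.
have [E [e [injE inj_e ess_e]]] := ex_injective_hull (in_sigma_submodule inj_u).
have [sE _] := injE.
have ess_sub (S : submodClosed E) y : y \in S -> y != 0 ->
    exists z, e z \in S /\ z != 0.
  move=> Sy y0; have [|z [Sz ez0]] := ess_e S; first by exists y.
  by exists z; split=> //; apply: contra_neq ez0 => ->; rewrite linear0.
exists E, e; split=> //; split=> //.
- by exists (e x); apply: contra_neq x0; apply: inj_eq0.
- move=> A B _ AB0; apply: contrapT => /not_orP[nA nB].
  have nz (S : submodClosed E) : ~ (forall y, y \in S -> y = 0) ->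
      exists z, e z \in S /\ z != 0.
    move=> nS; have [y [Sy y0]] : exists y, y \in S /\ y != 0.
      apply: contrapT => noy; apply: nS => y Sy; apply/eqP/negPn/negP => y0.
      by apply: noy; exists y.
    exact: ess_sub Sy y0.
  have [z1 [Az1 z10]] := nz A nA; have [z2 [Bz2 z20]] := nz B nB.
  have [A' A'E] := ex_preimage e A; have [B' B'E] := ex_preimage e B.
  have [||z [/A'E Az /B'E Bz /eqP]] := meetU A' B'.
  + by exists z1 => //; apply/A'E.
  + by exists z2 => //; apply/B'E.
  by apply; apply: (inj_eq0 inj_e); apply: AB0.
- move=> K /(chiP _ (in_sigma_self M))[_ noK] y Ky.
  apply/eqP/negPn/negP => y0; apply: noK.
  have [z [Kz z0]] := ess_sub K y Ky y0.
  have [K' K'E] := ex_preimage e K.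
  have [i [inj_i _ iK' iS]] := ex_submod_val K'.
  have [k [inj_k _ kK kS]] := ex_submod_val K.
  have [|j jE] := @ex_corestrict R _ _ _ k (e \o i) inj_k.
    by move=> b; apply/kS/K'E.
  exists (submod K'), j, (u \o i); split.
    by move=> b c /(congr1 k); rewrite !jE => /inj_e/inj_i.
  have [z' z'E] : exists z', i z' = z by apply/iS/K'E.
  by exists z'; rewrite /= z'E; apply: contra_neq z0; apply: inj_eq0.
Qed.

(** Since [U] is not chi(U)-torsion, some submodule [A] of [U] has a nonzero map
    to [U'].  Its image [W] is uniform and is a quotient of [A], so it embeds
    back in [A]. *)
Lemma chi_uniform_common U U' (u : {linear U -> M}) (u' : {linear U' -> M}) :
  uniform U -> uniform U' -> injective u -> injective u' ->
  chi M U = chi M U' ->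
  exists W (i : {linear W -> U}) (i' : {linear W -> U'}),
    [/\ exists w : W, w != 0, injective i & injective i'].
Proof.
move=> uniU uniU' inj_u inj_u' chiUU'; have [[x x0] _] := uniU.
have sU := in_sigma_submodule inj_u; have sU' := in_sigma_submodule inj_u'.
have : ~ chi M U U.
  by rewrite chiP // => -[_]; apply; exists U, idfun, idfun; split=> //; exists x.
rewrite chiUU' chiP // => /not_andP[//|/contrapT[A [j [f [inj_j [a fa0]]]]]].
have [W [p [i' [inj_i' ip surj_p]]]] := ex_image f.
have W0 : exists w : W, w != 0.
  by exists (p a); rewrite -ip in fa0; apply: contra_neq fa0 => ->; rewrite linear0.
have uniW := uniform_inj inj_i' W0 uniU'.
have inj_ui : injective (u' \o i') by move=> b c /= /inj_u'/inj_i'.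
have sA := in_sigma_inj inj_j sU.
have [s inj_s] := uniform_split projM semiM accM uniW inj_ui sA surj_p.
by exists W, (j \o s), i'; split=> // b c /= /inj_j/inj_s.
Qed.

End MinimalPrimes.

Theorem corollary2p10 (R : pzRingType) (M : lmodType R)
    (hproj : projective_in_sigma M M)
    (hsemi : semiprime_module M)
    (hacc : acc_on_annihilators M)
    (hunif : submodules_contain_uniform M)
    (EE : lmodType R -> Prop)
    (hEE : complete_representatives M (chi M M) EE) :
  exists F : lmodType R -> torsion_theory R,
    class_bij EE (min_prime_theories M) F.
Proof.
have [EEind EErep] := hEE.
exists (chi M); split=> [E /EEind[indE tfE injE]|E E' EE_E EE_E' chiEE'|_ [P minP ->]].
(* chi(E) is the theory of a minimal prime. *)
- have [U [u [e [uniU inj_u inj_e ess_e]]]] :=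
    indecomposable_ex_uniform hproj hsemi hacc hunif indE tfE injE.
  have [P PE] := ex_reject M U.
  exists P.
    exact (reject_minimal_prime hproj hsemi hacc uniU inj_u PE).
  rewrite (chi_quot_reject hproj hsemi hacc uniU inj_u PE).
  by apply: chi_essential inj_e ess_e; case: injE.
(* chi(E) = chi(E') forces E and E' to be isomorphic, hence equal. *)
- have [indE tfE injE] := EEind _ EE_E; have [indE' tfE' injE'] := EEind _ EE_E'.
  have [U [u [e [uniU inj_u inj_e ess_e]]]] :=
    indecomposable_ex_uniform hproj hsemi hacc hunif indE tfE injE.
  have [U' [u' [e' [uniU' inj_u' inj_e' ess_e']]]] :=
    indecomposable_ex_uniform hproj hsemi hacc hunif indE' tfE' injE'.
  have chiUU' : chi M U = chi M U'.
    by rewrite -(chi_essential injE.1 inj_e ess_e) -(chi_essential injE'.1 inj_e' ess_e').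
  have [W [i [i' [W0 inj_i inj_i']]]] :=
    chi_uniform_common hproj hsemi hacc uniU uniU' inj_u inj_u' chiUU'.
  have isoEE' : isomorphic E' E.
    apply: (@indecomposable_iso _ M W E E' (e \o i) (e' \o i')) => //.
      by move=> b c /= /inj_e/inj_i.
    by move=> b c /= /inj_e'/inj_i'.
  have [E0 [_ uniqE0]] := EErep E' (EEind _ EE_E').
  rewrite -(uniqE0 E) // -(uniqE0 E') //; split=> //.
  by exists idfun; exists idfun.
(* A minimal prime is the reject of some U, and the hull of U has a
   representative E'. *)
- have [U [u [uniU inj_u PE]]] :=
    minimal_prime_reject hproj hsemi hacc hunif minP.
  have [E [e [indE tfE injE inj_e ess_e]]] := uniform_hull uniU inj_u.
  have [E' [[EE_E' [phi bij_phi]] _]] := EErep E (And3 indE tfE injE).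
  exists E' => //.
  rewrite (chi_quot_reject hproj hsemi hacc uniU inj_u PE).
  rewrite -(chi_essential injE.1 inj_e ess_e).
  have [_ _ injE'] := EEind _ EE_E'.
  apply/esym; rewrite (@chi_essential _ M E E' phi) //; first by case: injE'.
    exact: bij_inj.
  have [psi _ psiK] := bij_phi; apply/essentialP => y y0.
  by exists 1, (psi y); rewrite psiK scale1r.
Qed.
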